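(* The canonical double functor $\mathbb{T}\mathrm{wCoref}\to\mathbb{L}\mathrm{LP}(\mathbb{L}\mathrm{ens})$, which is the identity on objects and horizontal morphisms and sends a twisted coreflection $(f\dashv q,\varepsilon)$ to the functor $f$ equipped with the canonical lifts of $(f\dashv q,\varepsilon)$ against delta lenses (described in the context), is invertible.
   Context: $\mathcal{C}\mathrm{at}$ is the category of small categories and functors. A double category is an internal category in the category of locally small categories; it is thin if each cell is determined by its boundary, and then a cell $f\to g$ is written $(h,k)$ with $h$ the top and $k$ the bottom horizontal morphism. $\mathbb{S}\mathrm{q}(\mathcal{C}\mathrm{at})$ is the double category of small categories, functors (both as horizontal and vertical morphisms) and commutative squares. **Delta lenses.** A delta lens $(f,\varphi)\colon A\nrightarrow B$ is a functor $f\colon A\to B$ with a choice, for each object $a\in A$ and morphism $u\colon fa\to b$ in $B$, of a morphism $\varphi(a,u)\colon a\to a'$ in $A$ such that $f\varphi(a,u)=u$, $\varphi(a,1_{fa})=1_a$, and $\varphi(a,v\circ u)=\varphi(a',v)\circ\varphi(a,u)$. The composite of $(f,\varphi)\colon A\nrightarrow B$ and $(g,\psi)\colon B\nrightarrow C$ is $(gf,\theta)$ with $\theta(a,u)=\varphi(a,\psi(fa,u))$. $\mathbb{L}\mathrm{ens}$ is the thin double category of small categories, functors (horizontal), delta lenses (vertical); a cell $(f,\varphi)\to(g,\psi)$ is a commutative square $gh=kf$ of functors with $h\varphi(a,u)=\psi(ha,ku)$. The double functor $V\colon\mathbb{L}\mathrm{ens}\to\mathbb{S}\mathrm{q}(\mathcal{C}\mathrm{at})$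 sends $(f,\varphi)$ to $f$. **Twisted coreflections.** A split coreflection $(f\dashv q,\varepsilon)\colon A\nrightarrow B$ consists of functors $f\colon A\to B$, $q\colon B\to A$ and a natural transformation $\varepsilon\colon fq\Rightarrow 1_B$ with $qf=1_A$, $q\cdot\varepsilon=1_q$, $\varepsilon\cdot f=1_f$. It is a twisted coreflection if for each $u\colon x\to y$ in $B$ with $qu$ not an identity morphism there is a unique $\overline{q}u\colon x\to fqx$ with $\overline{q}u\circ\varepsilon_x=1_{fqx}$ and $u=\varepsilon_y\circ fqu\circ\overline{q}u$. The composite of $(f\dashv q,\varepsilon)\colon A\nrightarrow B$ and $(g\dashv p,\zeta)\colon B\nrightarrow C$ is $(gf\dashv qp,\theta)$ with $\theta_x=\zeta_x\circ g\varepsilon_{px}$. $\mathbb{T}\mathrm{wCoref}$ is the thin double category of small categories, functors, twisted coreflections; a cell $(f\dashv q,\varepsilon)\to(g\dashv p,\zeta)$ is a pair $(h,k)$ of functors with $kf=gh$, $hq=pk$, $k\cdot\varepsilon=\zeta\cdot k$. **Canonical lifts.** Let $(f\dashv q,\varepsilon)\colon A\nrightarrow B$ be a twisted coreflection, $(g,\psi)\colon C\nrightarrow D$ a delta lens, and $h\colon A\to C$, $k\colon B\to D$ functors with $kf=gh$. Let $\iota_A\colon A_0\to A$ be the identity-on-objects inclusion of the discrete category on the objects of $A$, $X=\sum_{a\in A_0}q^{-1}\{a\}$ the coproduct of the fibres of $q$ (the pullback of $q$ along $\iota_A$), $\pi\colon X\to B$ the projection, and $f'\colon A_0\to X$, $a\mapsto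 fa$; $f'$ is an initial functor and $\pi f'=f\iota_A$ is a pushout square. Let $Y$ be the wide subcategory of $C$ on the morphisms $\psi(c,u)$, with inclusion $\bar\psi\colon Y\to C$; $g\bar\psi$ is a discrete opfibration. Let $\hat h\colon A_0\to Y$ be the unique functor with $\bar\psi\hat h=h\iota_A$, let $\ell\colon X\to Y$ be the unique functor with $\ell f'=\hat h$ and $g\bar\psi\ell=k\pi$ (initial functors are orthogonal to discrete opfibrations), and let the canonical lift be the unique functor $j\colon B\to C$ with $jf=h$ and $j\pi=\bar\psi\ell$; it satisfies $gj=k$. These lifts form a lifting operation on the cospan $\mathbb{T}\mathrm{wCoref}\to\mathbb{S}\mathrm{q}(\mathcal{C}\mathrm{at})\leftarrow\mathbb{L}\mathrm{ens}$, i.e. they are natural in cells and respect vertical composition on both sides. **Left lifts.** $\mathbb{L}\mathrm{LP}(\mathbb{L}\mathrm{ens})$ is the following thin double category. Objects and horizontal morphisms are small categories and functors. A vertical morphism $A\nrightarrow B$ is a pair $(f,\lambda)$ of a functor $f\colon A\to B$ and a function assigning to each delta lens $(g,\psi)\colon C\nrightarrow D$ and functors $s\colon A\to C$, $t\colon B\to D$ with $gs=tf$ a functor $\lambda_{(g,\psi)}(s,t)\colon B\to C$ with $\lambda_{(g,\psi)}(s,t)\circ f=s$ and $g\circ\lambda_{(g,\psi)}(s,t)=t$, such that: for each cell $(r_0,r_1)\colon(g,\psi)\to(g',\psi')$ of $\mathbb{L}\mathrm{ens}$, $r_0\circ\lambda_{(g,\psi)}(s,t)=\lambda_{(g',\psi')}(r_0s,r_1t)$;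 and for composable delta lenses $k=(g,\psi)$ and $l$, $\lambda_{l\circ k}(s,t)=\lambda_k(s,\lambda_l(g\circ s,t))$. A cell $(f,\lambda)\to(f',\lambda')$ is a commutative square $(h,m)\colon f\to f'$ of functors with $\lambda'_k(s,t)\circ m=\lambda_k(sh,tm)$ for all delta lenses $k$. The composite of $(f,\lambda)\colon A\nrightarrow B$ and $(f',\lambda')\colon B\nrightarrow C$ is $(f'f,\theta)$ with $\theta_k(s,t)=\lambda'_k(\lambda_k(s,tf'),t)$. *)

(* Defs.v *)
From Corelib Require Import ssreflect.
From Stdlib Require Import FunctionalExtensionality ProofIrrelevance.
From Stdlib Require Import Classical ClassicalEpsilon.

Set Implicit Arguments.
Unset Strict Implicit.
Unset Printing Implicit Defensive.
Set SsrOldRewriteGoalsOrder.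

Declare Scope cat_scope.
Delimit Scope cat_scope with cat.
Local Open Scope cat_scope.

(* Small categories are internal categories in types: a type of objects, a type
   of all morphisms, and a composition defined on composable pairs.  Equalities
   of objects, morphisms and functors, on which the strict notions below depend,
   are then plain equalities without transports.  Laws which mention composites
   quantify over all proofs of composability; by proof irrelevance the choice
   does not matter. *)
Record Category := {
  Ob :> Type;
  Mor : Type;
  dom : Mor -> Ob;
  cod : Mor -> Ob;
  id : Ob -> Mor;
  comp : forall g f : Mor, cod f = dom g -> Mor;
  dom_id : forall a, dom (id a) = a;
  cod_id : forall a, cod (id a) = a;
  dom_comp : forall g f e, dom (@comp g f e) = dom f;
  cod_comp : forall g f e, cod (@comp g f e) = cod g;
  comp_idl : forall a f e, @comp (id a) f e = f;
  comp_idr : forall a f e, @comp f (id a) e = f;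
  comp_assoc : forall h g f e1 e2 e3 e4,
    @comp h (@comp g f e1) e2 = @comp (@comp h g e3) f e4
}.

Arguments Mor : clear implicits.
Arguments id {c} a.
Arguments comp {c} g f e.

Definition is_identity {A : Category} (m : Mor A) : Prop :=
  exists a : A, m = id a.

Record Functor (A B : Category) := {
  fob :> A -> B;
  fmor : Mor A -> Mor B;
  fmor_dom : forall m, dom (fmor m) = fob (dom m);
  fmor_cod : forall m, cod (fmor m) = fob (cod m);
  fmor_id : forall a, fmor (id a) = id (fob a);
  fmor_comp : forall g f e e', fmor (comp g f e) = comp (fmor g) (fmor f) e'
}.

Lemma functor_ext (A B : Category) (F G : Functor A B) :
  (forall m, fmor F m = fmor G m) -> F = G.
Proof.
move=> H.
have Hob : fob F = fob G.
  apply: functional_extensionality => a.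
  by rewrite -(dom_id (F a)) -fmor_id H fmor_id dom_id.
have Hmor : fmor F = fmor G by apply: functional_extensionality.
case: F G {H} Hob Hmor => [fo fm p1 p2 p3 p4] [go gm q1 q2 q3 q4] /= Ho Hm.
subst; f_equal; apply: proof_irrelevance.
Qed.

Definition fun_id (A : Category) : Functor A A.
Proof.
refine {| fob := fun a : A => a; fmor := fun m : Mor A => m |} => //.
move=> g f e e'; f_equal; exact: proof_irrelevance.
Defined.

Definition fun_comp (A B C : Category) (G : Functor B C) (F : Functor A B) :
  Functor A C.
Proof.
refine {| fob := fun a => G (F a); fmor := fun m => fmor G (fmor F m) |}.
- by move=> m; rewrite !fmor_dom.
- by move=> m; rewrite !fmor_cod.
- by move=> a; rewrite !fmor_id.
- move=> g f e e'.
  have e1 : cod (fmor F f) = dom (fmor F g) by rewrite fmor_cod fmor_dom e.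
  by rewrite (@fmor_comp _ _ F g f e e1) (@fmor_comp _ _ G _ _ e1 e').
Defined.

Notation "G \o F" := (fun_comp G F)
  (at level 50, left associativity) : cat_scope.

Lemma fun_compA (A B C D : Category) (H : Functor C D) (G : Functor B C)
    (F : Functor A B) : H \o (G \o F) = (H \o G) \o F.
Proof. exact: functor_ext. Qed.

Lemma fun_idl (A B : Category) (F : Functor A B) : fun_id B \o F = F.
Proof. exact: functor_ext. Qed.

Lemma fun_idr (A B : Category) (F : Functor A B) : F \o fun_id A = F.
Proof. exact: functor_ext. Qed.

Lemma fob_eq (A B : Category) (F G : Functor A B) : F = G ->
  forall a, F a = G a.
Proof. by move->. Qed.

Lemma fmor_eq (A B : Category) (F G : Functor A B) : F = G ->
  forall m, fmor F m = fmor G m.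
Proof. by move->. Qed.

(* Only used in proofs: a total composition, agreeing with [comp] on composable
   pairs. *)
Definition tcomp {A : Category} (g f : Mor A) : Mor A :=
  match excluded_middle_informative (cod f = dom g) with
  | left e => comp g f e
  | right _ => f
  end.

Notation "g ** f" := (tcomp g f) (at level 40, left associativity) : cat_scope.

Lemma compE (A : Category) (g f : Mor A) e : comp g f e = g ** f.
Proof.
rewrite /tcomp; case: excluded_middle_informative => [e'|//].
f_equal; exact: proof_irrelevance.
Qed.

Lemma dom_tcomp (A : Category) (g f : Mor A) :
  cod f = dom g -> dom (g ** f) = dom f.
Proof. by move=> e; rewrite -(compE e) dom_comp. Qed.

Lemma cod_tcomp (A : Category) (g f : Mor A) :
  cod f = dom g -> cod (g ** f) = cod g.
Proof. by move=> e; rewrite -(compE e) cod_comp. Qed.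

Lemma tcomp_idl (A : Category) (a : A) (f : Mor A) : cod f = a -> id a ** f = f.
Proof.
move=> e; have e' : cod f = dom (id a) by rewrite dom_id.
by rewrite -(compE e') comp_idl.
Qed.

Lemma tcomp_idr (A : Category) (a : A) (f : Mor A) : dom f = a -> f ** id a = f.
Proof.
move=> e; have e' : cod (id a) = dom f by rewrite cod_id.
by rewrite -(compE e') comp_idr.
Qed.

Lemma tcompA (A : Category) (h g f : Mor A) :
  cod f = dom g -> cod g = dom h -> h ** (g ** f) = (h ** g) ** f.
Proof.
move=> e1 e3; rewrite -(compE e1) -(compE e3).
have e2 : cod (comp g f e1) = dom h by rewrite cod_comp.
have e4 : cod f = dom (comp h g e3) by rewrite dom_comp.
by rewrite -(compE e2) -(compE e4); apply: comp_assoc.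
Qed.

Lemma fmor_tcomp (A B : Category) (F : Functor A B) (g f : Mor A) :
  cod f = dom g -> fmor F (g ** f) = fmor F g ** fmor F f.
Proof.
move=> e; have e' : cod (fmor F f) = dom (fmor F g)
  by rewrite fmor_cod fmor_dom e.
by rewrite -(compE e) -(compE e'); apply: fmor_comp.
Qed.

Lemma identityE (A : Category) (m : Mor A) : is_identity m -> m = id (dom m).
Proof. by case=> a ->; rewrite dom_id. Qed.

Lemma identity_cod (A : Category) (m : Mor A) : is_identity m -> cod m = dom m.
Proof. by case=> a ->; rewrite dom_id cod_id. Qed.

Lemma fmor_identity (A B : Category) (F : Functor A B) (m : Mor A) :
  is_identity m -> is_identity (fmor F m).
Proof. by case=> a ->; exists (F a); rewrite fmor_id. Qed.

Lemma id_identity (A : Category) (a : A) : is_identity (id a).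
Proof. by exists a. Qed.

(* Cells of a thin double category are determined by their boundary, hence are
   given by a proposition on boundaries
<<
             h
        A ------> B
        |         |
      f |         | g
        v         v
        C ------> D
             k
>>
   The axioms on cells hold automatically. *)
Record ThinDoubleCategory := {
  dob :> Type;
  hor : dob -> dob -> Type;
  ver : dob -> dob -> Type;
  hid : forall A, hor A A;
  hcomp : forall A B C, hor B C -> hor A B -> hor A C;
  hcomp_idl : forall A B (h : hor A B), hcomp (hid B) h = h;
  hcomp_idr : forall A B (h : hor A B), hcomp h (hid A) = h;
  hcomp_assoc : forall A B C D (l : hor C D) (k : hor B C) (h : hor A B),
    hcomp l (hcomp k h) = hcomp (hcomp l k) h;
  vid : forall A, ver A A;
  vcomp : forall A B C, ver B C -> ver A B -> ver A C;
  vcomp_idl : forall A B (f : ver A B), vcomp (vid B) f = f;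
  vcomp_idr : forall A B (f : ver A B), vcomp f (vid A) = f;
  vcomp_assoc : forall A B C D (g2 : ver C D) (g1 : ver B C) (f : ver A B),
    vcomp g2 (vcomp g1 f) = vcomp (vcomp g2 g1) f;
  cell : forall A B C D, ver A C -> ver B D -> hor A B -> hor C D -> Prop;
  cell_hid : forall A C (f : ver A C), cell f f (hid A) (hid C);
  cell_hcomp : forall A B C A' B' C'
    (f : ver A A') (g : ver B B') (g' : ver C C')
    (h : hor A B) (h' : hor B C) (k : hor A' B') (k' : hor B' C'),
    cell f g h k -> cell g g' h' k' -> cell f g' (hcomp h' h) (hcomp k' k);
  cell_vid : forall A B (h : hor A B), cell (vid A) (vid B) h h;
  cell_vcomp : forall A B A' B' A'' B''
    (f : ver A A') (f' : ver A' A'') (g : ver B B') (g' : ver B' B'')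
    (h : hor A B) (k : hor A' B') (l : hor A'' B''),
    cell f g h k -> cell f' g' k l -> cell (vcomp f' f) (vcomp g' g) h l
}.

Arguments hor {t} A B.
Arguments ver {t} A B.
Arguments hid {t} A.
Arguments vid {t} A.

(* The action on cells is determined by the action on boundaries. *)
Record DoubleFunctor (D E : ThinDoubleCategory) := {
  df_ob :> D -> E;
  df_hor : forall A B : D, hor A B -> hor (df_ob A) (df_ob B);
  df_ver : forall A B : D, ver A B -> ver (df_ob A) (df_ob B);
  df_hid : forall A : D, df_hor (hid A) = hid (df_ob A);
  df_hcomp : forall (A B C : D) (k : hor B C) (h : hor A B),
    df_hor (hcomp k h) = hcomp (df_hor k) (df_hor h);
  df_vid : forall A : D, df_ver (vid A) = vid (df_ob A);
  df_vcomp : forall (A B C : D) (g : ver B C) (f : ver A B),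
    df_ver (vcomp g f) = vcomp (df_ver g) (df_ver f);
  df_cell : forall (A B C C' : D) (f : ver A C) (g : ver B C')
    (h : hor A B) (k : hor C C'),
    cell f g h k -> cell (df_ver f) (df_ver g) (df_hor h) (df_hor k)
}.

Definition df_id (D : ThinDoubleCategory) : DoubleFunctor D D.
Proof.
by refine {| df_ob := fun A : D => A; df_hor := fun _ _ h => h;
             df_ver := fun _ _ f => f |}.
Defined.

Definition df_comp (C D E : ThinDoubleCategory)
  (G : DoubleFunctor D E) (F : DoubleFunctor C D) : DoubleFunctor C E.
Proof.
refine {| df_ob := fun A => G (F A);
          df_hor := fun _ _ h => df_hor G (df_hor F h);
          df_ver := fun _ _ f => df_ver G (df_ver F f) |}.
- by move=> A; rewrite !df_hid.
- by move=> *; rewrite !df_hcomp.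
- by move=> A; rewrite !df_vid.
- by move=> *; rewrite !df_vcomp.
- by move=> *; do 2! apply: df_cell.
Defined.

Definition df_invertible (D E : ThinDoubleCategory) (F : DoubleFunctor D E) :
  Prop :=
  exists G : DoubleFunctor E D, df_comp G F = df_id D /\ df_comp F G = df_id E.

Record DeltaLens (A B : Category) := {
  lens_fun :> Functor A B;
  lift : forall (a : A) (u : Mor B), dom u = lens_fun a -> Mor A;
  lift_dom : forall a u e, dom (@lift a u e) = a;
  lift_over : forall a u e, fmor lens_fun (@lift a u e) = u;
  lift_id : forall a e, @lift a (id (lens_fun a)) e = id a;
  lift_comp : forall a u v e e1 e2 e3 e4,
    @lift a (comp v u e) e1 =
    comp (@lift (cod (@lift a u e2)) v e3) (@lift a u e2) e4
}.

Arguments lift {A B} d a u e.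

(* Only used in proofs: a total version of [lift]. *)
Definition tlift {A B : Category} (l : DeltaLens A B) (a : A) (u : Mor B) :
  Mor A :=
  match excluded_middle_informative (dom u = l a) with
  | left e => lift l a u e
  | right _ => id a
  end.

Lemma liftE (A B : Category) (l : DeltaLens A B) a u (e : dom u = l a) :
  lift l a u e = tlift l a u.
Proof.
rewrite /tlift; case: excluded_middle_informative => [e'|//].
f_equal; exact: proof_irrelevance.
Qed.

Lemma dom_tlift (A B : Category) (l : DeltaLens A B) a u :
  dom (tlift l a u) = a.
Proof.
rewrite /tlift; case: excluded_middle_informative => [e|ne].
- by rewrite lift_dom.
- by rewrite dom_id.
Qed.

Lemma tlift_over (A B : Category) (l : DeltaLens A B) a u :
  dom u = l a -> fmor l (tlift l a u) = u.
Proof. by move=> e; rewrite -(liftE e) lift_over. Qed.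

Lemma cod_tlift (A B : Category) (l : DeltaLens A B) a u :
  dom u = l a -> l (cod (tlift l a u)) = cod u.
Proof. by move=> e; rewrite -fmor_cod tlift_over. Qed.

Lemma tlift_id (A B : Category) (l : DeltaLens A B) (a : A) (b : B) :
  b = l a -> tlift l a (id b) = id a.
Proof.
move=> ->; have e : dom (id (l a)) = l a by rewrite dom_id.
by rewrite -(liftE e) lift_id.
Qed.

Lemma tlift_comp (A B : Category) (l : DeltaLens A B) a u v :
  dom u = l a -> cod u = dom v ->
  tlift l a (v ** u) = tlift l (cod (tlift l a u)) v ** tlift l a u.
Proof.
move=> e2 e.
have e1 : dom (v ** u) = l a by rewrite dom_tcomp.
have e3 : dom v = l (cod (lift _ _ _ e2)) by rewrite liftE cod_tlift.
have e4 : cod (lift _ _ _ e2) = dom (lift _ _ _ e3) by rewrite lift_dom.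
rewrite -(liftE e1) -(liftE e2) -(liftE e3) -(compE e4).
move: e1; rewrite -(compE e) => e1; exact: lift_comp.
Qed.

Lemma lens_ext (A B : Category) (l m : DeltaLens A B) :
  lens_fun l = lens_fun m ->
  (forall a u, dom u = l a -> tlift l a u = tlift m a u) -> l = m.
Proof.
case: l m => [f p a1 a2 a3 a4] [g q b1 b2 b3 b4] /= E H; subst g.
have E : p = q.
  apply: functional_extensionality_dep => a.
  apply: functional_extensionality_dep => u.
  apply: functional_extensionality_dep => e.
  by move: (H a u e); rewrite -!liftE /=.
subst q; f_equal; exact: proof_irrelevance.
Qed.

Definition lens_id (A : Category) : DeltaLens A A.
Proof.
refine {| lens_fun := fun_id A; lift := fun _ u _ => u |} => //=.
move=> *; f_equal; exact: proof_irrelevance.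
Defined.

Definition lens_comp (A B C : Category) (g : DeltaLens B C)
  (f : DeltaLens A B) : DeltaLens A C.
Proof.
refine {| lens_fun := g \o f;
          lift := fun a u (e : dom u = g (f a)) =>
            lift f a (lift g (f a) u e) (lift_dom e) |} => /=.
- by move=> *; rewrite lift_dom.
- by move=> *; rewrite !lift_over.
- by move=> a e; rewrite !liftE !tlift_id.
- move=> a u v e e1 e2 e3 e4; rewrite (compE e4).
  rewrite (liftE (lift_dom e3)) (liftE e3) (liftE (lift_dom e2)) (liftE e2).
  rewrite (liftE (lift_dom e1)) (liftE e1) (compE e).
  have e5 : cod (tlift g (f a) u) = f (cod (tlift f a (tlift g (f a) u))).
    by rewrite cod_tlift // dom_tlift.
  by rewrite tlift_comp // tlift_comp ?dom_tlift // e5.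
Defined.

Definition lens_cell (A B C D : Category) (l : DeltaLens A C)
    (m : DeltaLens B D) (h : Functor A B) (k : Functor C D) : Prop :=
  m \o h = k \o l /\
  forall a u (e : dom u = l a) (e' : dom (fmor k u) = m (h a)),
    fmor h (lift l a u e) = lift m (h a) (fmor k u) e'.

Lemma lens_cell_tlift (A B C D : Category) (l : DeltaLens A C)
    (m : DeltaLens B D) (h : Functor A B) (k : Functor C D) :
  lens_cell l m h k -> forall a u, dom u = l a ->
  fmor h (tlift l a u) = tlift m (h a) (fmor k u).
Proof.
case=> E H a u e.
have e' : dom (fmor k u) = m (h a)
  by rewrite fmor_dom e; move: (fob_eq E a) => /= ->.
by rewrite -(liftE e) -(liftE e').
Qed.

Lemma lens_comp_tlift (A B C : Category) (g : DeltaLens B C)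
    (f : DeltaLens A B) a u : dom u = g (f a) ->
  tlift (lens_comp g f) a u = tlift f a (tlift g (f a) u).
Proof.
move=> e; have e' : dom u = lens_comp g f a by [].
by rewrite -(liftE e') /= !liftE.
Qed.

Lemma lens_id_tlift (A : Category) (a : A) u : dom u = a ->
  tlift (lens_id A) a u = u.
Proof.
move=> e; have e' : dom u = lens_id A a by [].
by rewrite -(liftE e').
Qed.

Definition Lens : ThinDoubleCategory.
Proof.
refine {| dob := Category; hor := Functor; ver := DeltaLens;
  hid := fun_id; hcomp := fun_comp; vid := lens_id; vcomp := lens_comp;
  cell := lens_cell |}.
- exact: fun_idl.
- exact: fun_idr.
- exact: fun_compA.
- move=> A B f; apply: lens_ext => [|a u /= e]; first exact: fun_idl.
  by rewrite lens_comp_tlift // lens_id_tlift.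
- move=> A B f; apply: lens_ext => [|a u /= e]; first exact: fun_idr.
  by rewrite lens_comp_tlift //= lens_id_tlift // dom_tlift.
- move=> A B C D h g f; apply: lens_ext => [|a u /= e]; first exact: fun_compA.
  rewrite !lens_comp_tlift ?dom_tlift //; exact: e.
- move=> A C f; split; first by rewrite fun_idl fun_idr.
  by move=> *; rewrite !liftE.
- move=> A B C A' B' C' f g g' h h' k k' H1 H2; split.
    by rewrite fun_compA (proj1 H2) -!fun_compA (proj1 H1).
  move=> a u e e'; rewrite !liftE /= (lens_cell_tlift H1) //.
  rewrite (lens_cell_tlift H2) // fmor_dom e.
  by move: (fob_eq (proj1 H1) a) => /= ->.
- move=> A B h; split; first by rewrite fun_idl fun_idr.
  by move=> a u e e'; rewrite !liftE !lens_id_tlift.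
- move=> A B A' B' A'' B'' f f' g g' h k l H1 H2; split => /=.
    by rewrite -fun_compA (proj1 H1) fun_compA (proj1 H2) fun_compA.
  move=> a u e e'; rewrite !liftE (lens_cell_tlift H1) ?dom_tlift //.
  rewrite (lens_cell_tlift H2) //.
  by move: (fob_eq (proj1 H1) a) => /= ->.
Defined.

Record NatTrans (A B : Category) (F G : Functor A B) := {
  component :> A -> Mor B;
  component_dom : forall a, dom (component a) = F a;
  component_cod : forall a, cod (component a) = G a;
  component_nat : forall (u : Mor A) e e',
    comp (fmor G u) (component (dom u)) e =
    comp (component (cod u)) (fmor F u) e'
}.

Record SplitCoreflection (A B : Category) := {
  cor_fun : Functor A B;
  cor_retr : Functor B A;
  counit : NatTrans (cor_fun \o cor_retr) (fun_id B);
  retr_fun : cor_retr \o cor_fun = fun_id A;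
  retr_counit : forall x, fmor cor_retr (counit x) = id (cor_retr x);
  counit_fun : forall a, counit (cor_fun a) = id (cor_fun a)
}.

(* [w] has the two properties required of the morphism written q-bar(u). *)
Definition is_twist (A B : Category) (c : SplitCoreflection A B)
    (u w : Mor B) : Prop :=
  dom w = dom u /\
  cod w = cor_fun c (cor_retr c (dom u)) /\
  (forall e, comp w (counit c (dom u)) e
             = id (cor_fun c (cor_retr c (dom u)))) /\
  (forall e e', u = comp (comp (counit c (cod u))
                               (fmor (cor_fun c) (fmor (cor_retr c) u)) e)
                         w e').

Record TwistedCoreflection (A B : Category) := {
  tw_split :> SplitCoreflection A B;
  tw_twist : forall u, ~ is_identity (fmor (cor_retr tw_split) u) ->
    exists! w, is_twist tw_split u w
}.

Lemma counit_dom (A B : Category) (c : SplitCoreflection A B) x :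
  dom (counit c x) = cor_fun c (cor_retr c x).
Proof. by rewrite component_dom. Qed.

Lemma counit_cod (A B : Category) (c : SplitCoreflection A B) x :
  cod (counit c x) = x.
Proof. by rewrite component_cod. Qed.

Lemma retr_fob (A B : Category) (c : SplitCoreflection A B) a :
  cor_retr c (cor_fun c a) = a.
Proof. exact: (fob_eq (retr_fun c) a). Qed.

Lemma retr_fmor (A B : Category) (c : SplitCoreflection A B) m :
  fmor (cor_retr c) (fmor (cor_fun c) m) = m.
Proof. exact: (fmor_eq (retr_fun c) m). Qed.

Ltac cs :=
  repeat (progress (rewrite ?dom_id ?cod_id ?fmor_dom ?fmor_cod ?dom_tlift
                            ?counit_dom ?counit_cod ?retr_fob /=)
          || (rewrite dom_tcomp; [|solve [cs]])
          || (rewrite cod_tcomp; [|solve [cs]])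
          || match goal with H : cod _ = _ |- _ => rewrite H end);
  (done || congruence).

Lemma counit_nat (A B : Category) (c : SplitCoreflection A B) (u : Mor B) :
  u ** counit c (dom u) =
  counit c (cod u) ** fmor (cor_fun c) (fmor (cor_retr c) u).
Proof.
have e : cod (counit c (dom u)) = dom u by cs.
have e' : cod (fmor (cor_fun c) (fmor (cor_retr c) u)) = dom (counit c (cod u))
  by cs.
rewrite -(compE e) -(compE e').
exact (@component_nat _ _ _ _ (counit c) u e e').
Qed.

Lemma is_twistE (A B : Category) (c : SplitCoreflection A B) (u w : Mor B) :
  is_twist c u w <->
  dom w = dom u /\ cod w = cor_fun c (cor_retr c (dom u)) /\
  w ** counit c (dom u) = id (cor_fun c (cor_retr c (dom u))) /\
  u = (counit c (cod u) ** fmor (cor_fun c) (fmor (cor_retr c) u)) ** w.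
Proof.
split=> [] [Hd [Hc [H1 H2]]]; split=> //; split=> //; split.
- have e : cod (counit c (dom u)) = dom w by cs.
  by rewrite -(compE e).
- have e : cod (fmor (cor_fun c) (fmor (cor_retr c) u)) =
           dom (counit c (cod u)) by cs.
  have e' : cod w = dom (comp _ _ e) by rewrite compE; cs.
  by rewrite -(compE e) -(compE e').
- by move=> e; rewrite compE.
- by move=> e e'; rewrite (compE e') (compE e).
Qed.

Lemma is_twist_dom (A B : Category) (c : SplitCoreflection A B) (u w : Mor B) :
  is_twist c u w -> dom w = dom u.
Proof. by case. Qed.

Lemma is_twist_cod (A B : Category) (c : SplitCoreflection A B) (u w : Mor B) :
  is_twist c u w -> cod w = cor_fun c (cor_retr c (dom u)).
Proof. by case=> _ []. Qed.

Lemma is_twist_counit (A B : Category) (c : SplitCoreflection A B)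
    (u w : Mor B) :
  is_twist c u w ->
  w ** counit c (dom u) = id (cor_fun c (cor_retr c (dom u))).
Proof. by case/is_twistE=> _ [_ []]. Qed.

Lemma is_twist_eq (A B : Category) (c : SplitCoreflection A B) (u w : Mor B) :
  is_twist c u w ->
  u = counit c (cod u) ** (fmor (cor_fun c) (fmor (cor_retr c) u) ** w).
Proof.
move=> H; case/is_twistE: (H) => Hd [Hc [_ H2]].
by rewrite tcompA -?H2 //; cs.
Qed.

Lemma is_twist_retr (A B : Category) (c : SplitCoreflection A B) (u w : Mor B) :
  is_twist c u w -> fmor (cor_retr c) w = id (cor_retr c (dom u)).
Proof.
move=> H; have Hd := is_twist_dom H; have Hc := is_twist_cod H.
have := f_equal (fmor (cor_retr c)) (is_twist_counit H).
rewrite fmor_tcomp; last by cs.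
by rewrite retr_counit tcomp_idr ?fmor_id ?retr_fob //; cs.
Qed.

Lemma twist_unique (A B : Category) (c : TwistedCoreflection A B)
    (u w w' : Mor B) :
  ~ is_identity (fmor (cor_retr c) u) ->
  is_twist c u w -> is_twist c u w' -> w = w'.
Proof.
by move=> /(tw_twist (t := c)) [x [_ Hx]] /Hx <- /Hx <-.
Qed.

Lemma twisted_ext (A B : Category) (c d : TwistedCoreflection A B) :
  cor_fun c = cor_fun d -> cor_retr c = cor_retr d ->
  (forall x, counit c x = counit d x) -> c = d.
Proof.
case: c d => [[f q e a1 a2 a3] ac] [[g p z b1 b2 b3] bc] /= E1 E2.
move: a1 a2 a3 ac b1 b2 b3 bc; subst g p => a1 a2 a3 ac b1 b2 b3 bc H.
have E : e = z.
  case: e z H {a1 a2 a3 ac b1 b2 b3 bc} => [e x1 x2 x3] [z y1 y2 y3] /= H.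
  have E : e = z by apply: functional_extensionality.
  subst z; f_equal; exact: proof_irrelevance.
subst z; have E := proof_irrelevance _ a1 b1; subst b1.
have E := proof_irrelevance _ a2 b2; subst b2.
have E := proof_irrelevance _ a3 b3; subst b3.
f_equal; exact: proof_irrelevance.
Qed.

Definition split_id (A : Category) : SplitCoreflection A A.
Proof.
unshelve refine {| cor_fun := fun_id A; cor_retr := fun_id A;
  counit := Build_NatTrans (component := fun a : A => id a) _ _ _ |}.
- by move=> a; rewrite dom_id.
- by move=> a; rewrite cod_id.
- by move=> u e e'; rewrite comp_idl comp_idr.
- exact: fun_idl.
- by [].
- by [].
Defined.

Definition twisted_id (A : Category) : TwistedCoreflection A A.
Proof.
refine {| tw_split := split_id A |} => u Hu.
exists (id (dom u)); split=> [|w /is_twistE /= [Hd [Hc [H1 H2]]]].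
- apply/is_twistE=> /=; rewrite dom_id cod_id; do 2! split=> //; split.
  + by rewrite tcomp_idl //; cs.
  + by rewrite tcomp_idl // tcomp_idr.
- by move: H1; rewrite tcomp_idr.
Defined.

Lemma counit_comp_eq (A B C : Category) (d : SplitCoreflection B C)
    (c : SplitCoreflection A B) x :
  cod (fmor (cor_fun d) (counit c (cor_retr d x))) = dom (counit d x).
Proof. by cs. Qed.

Definition counit_comp (A B C : Category) (d : SplitCoreflection B C)
  (c : SplitCoreflection A B) :
  NatTrans ((cor_fun d \o cor_fun c) \o (cor_retr c \o cor_retr d)) (fun_id C).
Proof.
refine {| component := fun x : C =>
    comp (counit d x) (fmor (cor_fun d) (counit c (cor_retr d x)))
         (counit_comp_eq d c x) |}.
- by move=> x; rewrite compE /=; cs.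
- by move=> x; rewrite compE /=; cs.
- move=> u e e'; rewrite (compE e) (compE e') !(compE (counit_comp_eq _ _ _)).
  rewrite tcompA; try cs.
  rewrite counit_nat -tcompA; try cs.
  rewrite -fmor_tcomp; last by cs.
  have -> : cor_retr d (dom u) = dom (fmor (cor_retr d) u) by cs.
  rewrite counit_nat fmor_tcomp; last by cs.
  by rewrite tcompA; try cs; rewrite fmor_cod.
Defined.

Definition split_comp (A B C : Category) (d : SplitCoreflection B C)
  (c : SplitCoreflection A B) : SplitCoreflection A C.
Proof.
refine {| cor_fun := cor_fun d \o cor_fun c;
  cor_retr := cor_retr c \o cor_retr d; counit := counit_comp d c |}.
- rewrite -fun_compA (fun_compA (cor_retr d)) retr_fun fun_idl.
  exact: retr_fun.
- move=> x; rewrite /= compE fmor_tcomp; last by cs.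
  rewrite retr_counit retr_fmor fmor_tcomp; last by cs.
  by rewrite fmor_id retr_counit tcomp_idl //; cs.
- move=> a; rewrite /= compE retr_fob counit_fun counit_fun tcomp_idl.
  + by rewrite fmor_id.
  + by cs.
Defined.

Lemma counit_split_comp (A B C : Category) (d : SplitCoreflection B C)
    (c : SplitCoreflection A B) x :
  counit (split_comp d c) x =
  counit d x ** fmor (cor_fun d) (counit c (cor_retr d x)).
Proof. by rewrite /= compE. Qed.

Section TwistedComp.
Variables (A B C : Category).
Variables (d : TwistedCoreflection B C) (c : TwistedCoreflection A B).
Local Notation f := (cor_fun c).
Local Notation q := (cor_retr c).
Local Notation g := (cor_fun d).
Local Notation p := (cor_retr d).

Lemma twist_comp_exists u (w1 w2 : Mor _) :
  is_twist d u w1 -> is_twist c (fmor p u) w2 ->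
  is_twist (split_comp d c) u (fmor g w2 ** w1).
Proof.
move=> H1 H2.
have d1 := is_twist_dom H1; have c1 := is_twist_cod H1.
have d2 := is_twist_dom H2; have c2 := is_twist_cod H2.
rewrite fmor_dom in d2 c2.
apply/is_twistE; split; first by cs.
split; first by rewrite /=; cs.
split.
- rewrite counit_split_comp tcompA; try cs.
  rewrite -(tcompA (h := fmor g w2)); try cs.
  rewrite (is_twist_counit H1) tcomp_idr; last by cs.
  rewrite -fmor_tcomp; last by cs.
  have := is_twist_counit H2; rewrite fmor_dom => ->.
  by rewrite fmor_id.
- rewrite counit_split_comp /=.
  have E1 := is_twist_eq H1; have E2 := is_twist_eq H2.
  rewrite {1}E1 {1}E2 fmor_cod fmor_tcomp; last by cs.
  rewrite fmor_tcomp; last by cs.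
  by rewrite !tcompA //; cs.
Qed.

Lemma twist_comp_unique u w w1 w2 :
  is_twist d u w1 -> is_twist c (fmor p u) w2 ->
  ~ is_identity (fmor p u) -> ~ is_identity (fmor q (fmor p u)) ->
  is_twist (split_comp d c) u w -> fmor g w2 ** w1 = w.
Proof.
move=> H1 H2 N1 N2 H.
have d1 := is_twist_dom H1; have c1 := is_twist_cod H1.
have d2 := is_twist_dom H2; have c2 := is_twist_cod H2.
have dw := is_twist_dom H; have cw := is_twist_cod H.
have Cw := is_twist_counit H; have Ew := is_twist_eq H.
rewrite /= in cw; rewrite fmor_dom in d2 c2.
rewrite counit_split_comp /= in Cw; rewrite counit_split_comp /= in Ew.
have pw : fmor p w = w2.
{ apply: (twist_unique N2 _ H2); apply/is_twistE.
  split; first by cs.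
  split; first by rewrite fmor_cod cw retr_fob fmor_dom.
  split.
  - have := f_equal (fmor p) Cw; rewrite tcompA; try cs.
    rewrite fmor_tcomp; last by cs.
    rewrite fmor_tcomp; last by cs.
    rewrite retr_counit tcomp_idr; last by cs.
    by rewrite retr_fmor fmor_id retr_fob fmor_dom.
  - have := f_equal (fmor p) Ew.
    rewrite fmor_tcomp; last by cs.
    rewrite fmor_tcomp; last by cs.
    rewrite fmor_tcomp; last by cs.
    rewrite retr_counit !retr_fmor tcomp_idl; last by cs.
    by move=> {1}->; rewrite !tcompA ?fmor_cod //; cs. }
have key w' : is_twist d u w' -> w = fmor g (fmor p w) ** w' ->
    fmor g w2 ** w1 = w.
  by move=> H' ->; rewrite pw (twist_unique N1 H1 H').
case: (classic (is_identity (fmor p w))) => [I|NI].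
- apply: (key w).
  { apply/is_twistE; split=> //.
    have Iw := identityE I; have cdw := identity_cod I.
    rewrite fmor_dom in Iw; rewrite fmor_cod fmor_dom in cdw.
    have Ep : f (q (p (dom u))) = p (dom u).
      by rewrite -{2}dw -cdw cw retr_fob.
    have Ce : counit c (p (dom u)) = id (p (dom u)).
      by rewrite -Ep counit_fun.
    split; first by cs.
    split.
    + move: Cw; rewrite Ce fmor_id tcomp_idr; last by cs.
      by rewrite Ep.
    + have E : fmor p u = counit c (p (cod u)) ** fmor f (fmor q (fmor p u)).
        have := counit_nat c (fmor p u).
        rewrite fmor_dom fmor_cod Ce tcomp_idr //; cs.
      rewrite E fmor_tcomp; last by cs.
      by rewrite {1}Ew !tcompA //; cs. }
  case: I => b Hb; rewrite Hb fmor_id tcomp_idl //.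
  have := f_equal (@cod B) Hb; rewrite fmor_cod cod_id => <-.
  by rewrite cw retr_fob.
- have [w' [H' _]] := tw_twist NI.
  have d' := is_twist_dom H'; have c' := is_twist_cod H'.
  have C' := is_twist_counit H'; have E' := is_twist_eq H'.
  have W : w = fmor g (fmor p w) ** w'.
    rewrite {1}E' cw counit_fun tcomp_idl //; cs.
  apply: (key w') => //; apply/is_twistE.
  split; first by cs.
  split; first by rewrite c' dw.
  split; first by move: C'; rewrite dw.
  have F1 : fmor p u = counit c (p (cod u)) **
      (fmor f (fmor q (fmor p u)) ** fmor p w).
    by have := is_twist_eq H2; rewrite pw fmor_cod.
  rewrite {1}F1 fmor_tcomp; last by cs.
  rewrite fmor_tcomp; last by cs.
  rewrite {1}Ew {1}W !tcompA //; cs.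
Qed.

Definition twisted_comp : TwistedCoreflection A C.
Proof.
refine {| tw_split := split_comp d c |} => u /= N2.
have N1 : ~ is_identity (fmor p u) by move=> I; apply/N2/fmor_identity.
have [w1 [H1 _]] := tw_twist N1.
have [w2 [H2 _]] := tw_twist N2.
exists (fmor g w2 ** w1); split; first exact: twist_comp_exists.
by move=> w; apply: twist_comp_unique.
Defined.

End TwistedComp.

Definition twisted_cell (A B C D : Category) (c : TwistedCoreflection A C)
    (d : TwistedCoreflection B D) (h : Functor A B) (k : Functor C D) : Prop :=
  k \o cor_fun c = cor_fun d \o h /\
  h \o cor_retr c = cor_retr d \o k /\
  forall x, fmor k (counit c x) = counit d (k x).

Definition TwCoref : ThinDoubleCategory.
Proof.
refine {| dob := Category; hor := Functor; ver := TwistedCoreflection;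
  hid := fun_id; hcomp := fun_comp; vid := twisted_id; vcomp := twisted_comp;
  cell := twisted_cell |}.
- exact: fun_idl.
- exact: fun_idr.
- exact: fun_compA.
- move=> A B c; apply: twisted_ext => [||x].
  + exact: fun_idl.
  + exact: fun_idr.
  + by rewrite counit_split_comp /= tcomp_idl //; cs.
- move=> A B c; apply: twisted_ext => [||x].
  + exact: fun_idr.
  + exact: fun_idl.
  + by rewrite counit_split_comp /= fmor_id tcomp_idr //; cs.
- move=> A B C D e d c; apply: twisted_ext => [||x].
  + exact: fun_compA.
  + by rewrite /= fun_compA.
  + rewrite !counit_split_comp fmor_tcomp; last by cs.
    by rewrite /= tcompA //; cs.
- by move=> A C c; split; last split=> //; rewrite ?fun_idl ?fun_idr.
- move=> A B C A' B' C' f g g' h h' k k' [a1 [a2 a3]] [b1 [b2 b3]]; split; last split.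
  + by rewrite -fun_compA a1 fun_compA b1 fun_compA.
  + by rewrite -fun_compA a2 fun_compA b2 fun_compA.
  + by move=> x /=; rewrite a3 b3.
- move=> A B h; split; last split; rewrite /= ?fun_idl ?fun_idr // => x.
  by rewrite fmor_id.
- move=> A B A' B' A'' B'' f f' g g' h k l [a1 [a2 a3]] [b1 [b2 b3]]; split; last split.
  + by rewrite /= fun_compA b1 -fun_compA a1 fun_compA.
  + by rewrite /= fun_compA a2 -fun_compA b2 fun_compA.
  + move=> x; rewrite !counit_split_comp fmor_tcomp; last by cs.
    rewrite b3; have /= -> := fmor_eq b1 (counit f (cor_retr f' x)).
    by rewrite a3; have /= -> := fob_eq b2 x.
Defined.

Record LeftLifting (A B : Category) := {
  ll_fun : Functor A B;
  ll_lift : forall (C D : Category) (k : DeltaLens C D)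
    (s : Functor A C) (t : Functor B D), k \o s = t \o ll_fun -> Functor B C;
  ll_upper : forall C D (k : DeltaLens C D) s t e,
    @ll_lift _ _ k s t e \o ll_fun = s;
  ll_lower : forall C D (k : DeltaLens C D) s t e,
    k \o @ll_lift _ _ k s t e = t;
  ll_natural : forall C D C' D' (k : DeltaLens C D) (k' : DeltaLens C' D')
      r0 r1 s t e e',
    lens_cell k k' r0 r1 ->
    r0 \o @ll_lift _ _ k s t e = @ll_lift _ _ k' (r0 \o s) (r1 \o t) e';
  ll_lens_comp : forall C D E (k : DeltaLens C D) (l : DeltaLens D E)
      s t e e1 e2,
    @ll_lift _ _ (lens_comp l k) s t e =
    @ll_lift _ _ k s (@ll_lift _ _ l (k \o s) t e1) e2
}.

Arguments ll_lift {A B} f {C D} k s t e : rename.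

Lemma ll_lift_eq (A B C D : Category) (f : LeftLifting A B)
    (k : DeltaLens C D) s s' t t' e e' : s = s' -> t = t' ->
  ll_lift f k s t e = ll_lift f k s' t' e'.
Proof. by move=> ? ?; subst; f_equal; apply: proof_irrelevance. Qed.

Lemma ll_ext (A B : Category) (f g : LeftLifting A B) :
  ll_fun f = ll_fun g ->
  (forall C D (k : DeltaLens C D) s t e e',
    ll_lift f k s t e = ll_lift g k s t e') -> f = g.
Proof.
case: f g => [f p a1 a2 a3 a4] [g q b1 b2 b3 b4] /= E H; subst g.
have E : p = q.
  apply: functional_extensionality_dep => C.
  apply: functional_extensionality_dep => D.
  apply: functional_extensionality_dep => k.
  apply: functional_extensionality_dep => s.
  apply: functional_extensionality_dep => t.
  by apply: functional_extensionality_dep => e.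
subst q; f_equal; exact: proof_irrelevance.
Qed.

Definition ll_id (A : Category) : LeftLifting A A.
Proof.
refine {| ll_fun := fun_id A; ll_lift := fun _ _ _ s _ _ => s |} => //.
- by move=> *; rewrite fun_idr.
- by move=> C D k s t e; rewrite e fun_idr.
Defined.

Lemma ll_comp_eq1 (A B C X Y : Category) (g : Functor B C)
    (f : Functor A B) (k : Functor X Y) s t :
  k \o s = t \o (g \o f) -> k \o s = (t \o g) \o f.
Proof. by move=> ->; rewrite fun_compA. Qed.

Definition ll_comp (A B C : Category) (g : LeftLifting B C)
  (f : LeftLifting A B) : LeftLifting A C.
Proof.
refine {| ll_fun := ll_fun g \o ll_fun f;
  ll_lift := fun X Y k s t e =>
    ll_lift g k (ll_lift f k s (t \o ll_fun g) (ll_comp_eq1 e)) t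
            (ll_lower _) |} => /=.
- by move=> *; rewrite fun_compA !ll_upper.
- by move=> *; rewrite ll_lower.
- move=> X Y X' Y' k k' r0 r1 s t e e' H.
  have E0 : k' \o (r0 \o s) = r1 \o (t \o ll_fun g) \o ll_fun f.
    by rewrite fun_compA (proj1 H) -!fun_compA e.
  have E1 : k' \o (r0 \o ll_lift f k s (t \o ll_fun g) (ll_comp_eq1 e))
            = (r1 \o t) \o ll_fun g.
    by rewrite fun_compA (proj1 H) -fun_compA ll_lower fun_compA.
  rewrite (ll_natural _ E1 H); apply: ll_lift_eq => //.
  by rewrite (ll_natural _ E0 H); apply: ll_lift_eq => //; rewrite fun_compA.
- move=> X Y Z k l s t e e1 e2.
  have E0 : l \o (k \o s) = t \o ll_fun g \o ll_fun f.
    by rewrite -(fun_compA t) -e fun_compA.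
  have E1 : k \o s = ll_lift f l (k \o s) (t \o ll_fun g) E0 \o ll_fun f.
    by rewrite ll_upper.
  have Ef (e0 : lens_comp l k \o s = t \o ll_fun g \o ll_fun f) :
      ll_lift f (lens_comp l k) s (t \o ll_fun g) e0 =
      ll_lift f k s (ll_lift f l (k \o s) (t \o ll_fun g) E0) E1.
    exact: ll_lens_comp.
  have E2 : l \o (k \o ll_lift f (lens_comp l k) s (t \o ll_fun g)
      (ll_comp_eq1 e)) = t \o ll_fun g.
    rewrite fun_compA.
    exact (@ll_lower _ _ f _ _ (lens_comp l k) s _ (ll_comp_eq1 e)).
  have E3 : k \o ll_lift f (lens_comp l k) s (t \o ll_fun g) (ll_comp_eq1 e) =
      ll_lift g l (k \o ll_lift f (lens_comp l k) s (t \o ll_fun g)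
        (ll_comp_eq1 e)) t E2 \o ll_fun g.
    by rewrite ll_upper.
  rewrite (ll_lens_comp _ E3); apply: ll_lift_eq.
  + by rewrite Ef; apply: ll_lift_eq => //; rewrite ll_upper; apply: ll_lift_eq.
  + by apply: ll_lift_eq => //; rewrite Ef ll_lower; apply: ll_lift_eq.
Defined.

Definition ll_cell (A B C D : Category) (f : LeftLifting A C)
    (f' : LeftLifting B D) (h : Functor A B) (m : Functor C D) : Prop :=
  m \o ll_fun f = ll_fun f' \o h /\
  forall X Y (k : DeltaLens X Y) s t e e',
    ll_lift f' k s t e \o m = ll_lift f k (s \o h) (t \o m) e'.

Definition LLPLens : ThinDoubleCategory.
Proof.
refine {| dob := Category; hor := Functor; ver := LeftLifting;
  hid := fun_id; hcomp := fun_comp; vid := ll_id; vcomp := ll_comp;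
  cell := ll_cell |}.
- exact: fun_idl.
- exact: fun_idr.
- exact: fun_compA.
- move=> A B f; apply: ll_ext => [|C D k s t e e' /=]; first exact: fun_idl.
  by apply: ll_lift_eq => //; apply: fun_idr.
- move=> A B f; apply: ll_ext => [|C D k s t e e' /=]; first exact: fun_idr.
  exact: ll_lift_eq.
- move=> A B C D f g h; apply: ll_ext => [|X Y k s t e e' /=].
    exact: fun_compA.
  by do 3! (apply: ll_lift_eq => //); rewrite fun_compA.
- move=> A C f; split; first by rewrite fun_idl fun_idr.
  by move=> *; rewrite fun_idr; apply: ll_lift_eq; rewrite ?fun_idr.
- move=> A B C A' B' C' f g g' h h' k k' [a1 a2] [b1 b2]; split.
    by rewrite -fun_compA a1 fun_compA b1 fun_compA.
  move=> X Y l s t e e'.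
  have E : l \o (s \o h') = (t \o k') \o ll_fun g.
    by rewrite fun_compA e -!fun_compA b1.
  have E' : l \o (s \o h' \o h) = (t \o k' \o k) \o ll_fun f.
    by rewrite fun_compA E -!fun_compA a1.
  rewrite fun_compA (b2 _ _ _ _ _ _ E) (a2 _ _ _ _ _ _ E').
  by apply: ll_lift_eq; rewrite fun_compA.
- by move=> A B h; split; rewrite /= ?fun_idl ?fun_idr.
- move=> A B A' B' A'' B'' f f' g g' h k l [a1 a2] [b1 b2]; split => /=.
    by rewrite fun_compA b1 -fun_compA a1 fun_compA.
  move=> X Y m s t e e'.
  have E : m \o (s \o h) = (t \o ll_fun g' \o k) \o ll_fun f.
    by rewrite fun_compA e -!fun_compA a1.
  have E' : m \o (ll_lift g m s (t \o ll_fun g') (ll_comp_eq1 e) \o k) =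
      (t \o l) \o ll_fun f'.
    by rewrite fun_compA ll_lower -!fun_compA b1.
  rewrite (b2 _ _ _ _ _ _ E'); apply: ll_lift_eq => //.
  rewrite (a2 _ _ _ _ _ _ E); apply: ll_lift_eq => //.
  by rewrite -!fun_compA b1.
Defined.

Definition discrete (T : Type) : Category.
Proof.
by refine {| Ob := T; Mor := T; dom := fun a => a; cod := fun a => a;
  id := fun a => a; comp := fun _ f _ => f |}.
Defined.

Definition discrete_incl (A : Category) : Functor (discrete A) A.
Proof.
refine {| fob := fun a : discrete A => a : A;
          fmor := fun a : Mor (discrete A) => id (a : A) |}.
- by move=> m; rewrite dom_id.
- by move=> m; rewrite cod_id.
- by [].
- by move=> g f /= e e'; subst; rewrite comp_idl.
Defined.

Lemma sig_eq (T : Type) (P : T -> Prop) (x y : {z : T | P z}) :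
  proj1_sig x = proj1_sig y -> x = y.
Proof.
case: x y => [x p] [y q] /= E; subst y; f_equal; exact: proof_irrelevance.
Qed.

Definition pullback (A B C : Category) (F : Functor A C) (G : Functor B C) :
  Category.
Proof.
unshelve refine {|
  Ob := {p : A * B | F (fst p) = G (snd p)};
  Mor := {m : Mor A * Mor B | fmor F (fst m) = fmor G (snd m)};
  dom := fun m => exist _ (dom (fst (proj1_sig m)), dom (snd (proj1_sig m))) _;
  cod := fun m => exist _ (cod (fst (proj1_sig m)), cod (snd (proj1_sig m))) _;
  id := fun p => exist _ (id (fst (proj1_sig p)), id (snd (proj1_sig p))) _;
  comp := fun n m e => exist _
    (comp (fst (proj1_sig n)) (fst (proj1_sig m))
          (f_equal (fun p => fst (proj1_sig p)) e),
     comp (snd (proj1_sig n)) (snd (proj1_sig m))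
          (f_equal (fun p => snd (proj1_sig p)) e)) _ |}.
- by case: m => [[m n] /= e]; rewrite -!fmor_dom e.
- by case: m => [[m n] /= e]; rewrite -!fmor_cod e.
- by case: p => [[a b] /= e]; rewrite !fmor_id e.
- case: n m e => [[n n'] /= en] [[m m'] /= em] e.
  rewrite !compE !fmor_tcomp ?en ?em //.
  + exact: (f_equal (fun p => snd (proj1_sig p)) e).
  + exact: (f_equal (fun p => fst (proj1_sig p)) e).
- by case=> [[a b] e]; apply: sig_eq; rewrite /= !dom_id.
- by case=> [[a b] e]; apply: sig_eq; rewrite /= !cod_id.
- by move=> n m e; apply: sig_eq; rewrite /= !dom_comp.
- by move=> n m e; apply: sig_eq; rewrite /= !cod_comp.
- by move=> p [[m m'] em] e; apply: sig_eq; rewrite /= !comp_idl.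
- by move=> p [[m m'] em] e; apply: sig_eq; rewrite /= !comp_idr.
- move=> h g f e1 e2 e3 e4; apply: sig_eq => /=; f_equal; exact: comp_assoc.
Defined.

Definition pullback_fst (A B C : Category) (F : Functor A C)
  (G : Functor B C) : Functor (pullback F G) A.
Proof.
refine {| fob := fun p : pullback F G => fst (proj1_sig p);
          fmor := fun m : Mor (pullback F G) => fst (proj1_sig m) |} => //.
by move=> g f e e' /=; f_equal; apply: proof_irrelevance.
Defined.

Definition pullback_pair (A B C D : Category) (F : Functor A C)
  (G : Functor B C) (H : Functor D A) (K : Functor D B)
  (E : F \o H = G \o K) : Functor D (pullback F G).
Proof.
refine {| fob := fun d => exist _ (H d, K d) (fob_eq E d) : pullback F G;
  fmor := fun m => exist _ (fmor H m, fmor K m) (fmor_eq E m)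
    : Mor (pullback F G) |}.
- by move=> m; apply: sig_eq; rewrite /= !fmor_dom.
- by move=> m; apply: sig_eq; rewrite /= !fmor_cod.
- by move=> a; apply: sig_eq; rewrite /= !fmor_id.
- move=> g f e e'; apply: sig_eq => /=; rewrite !compE.
  by rewrite !fmor_tcomp.
Defined.

Definition wide_subcategory (A : Category) (P : Mor A -> Prop)
  (Pid : forall a, P (id a))
  (Pcomp : forall g f e, P g -> P f -> P (comp g f e)) : Category.
Proof.
refine {| Ob := A; Mor := {m : Mor A | P m};
  dom := fun m => dom (proj1_sig m); cod := fun m => cod (proj1_sig m);
  id := fun a => exist _ (id a) (Pid a);
  comp := fun g f e => exist _ (comp (proj1_sig g) (proj1_sig f) e)
    (Pcomp _ _ e (proj2_sig g) (proj2_sig f)) |}.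
- by move=> a; rewrite /= dom_id.
- by move=> a; rewrite /= cod_id.
- by move=> *; rewrite /= dom_comp.
- by move=> *; rewrite /= cod_comp.
- by move=> *; apply: sig_eq; rewrite /= comp_idl.
- by move=> *; apply: sig_eq; rewrite /= comp_idr.
- by move=> *; apply: sig_eq; apply: comp_assoc.
Defined.

Definition is_chosen (C D : Category) (l : DeltaLens C D) (m : Mor C) : Prop :=
  exists c u e, m = lift l c u e.

Lemma tlift_chosen (C D : Category) (l : DeltaLens C D) c u :
  dom u = l c -> is_chosen l (tlift l c u).
Proof. by move=> e; exists c, u, e; rewrite liftE. Qed.

Lemma is_chosenE (C D : Category) (l : DeltaLens C D) m :
  is_chosen l m -> m = tlift l (dom m) (fmor l m).
Proof. by move=> [c [u [e ->]]]; rewrite lift_dom lift_over liftE. Qed.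

Lemma id_chosen (C D : Category) (l : DeltaLens C D) c : is_chosen l (id c).
Proof.
have e : dom (id (l c)) = l c by rewrite dom_id.
by exists c, (id (l c)), e; rewrite lift_id.
Qed.

Lemma comp_chosen (C D : Category) (l : DeltaLens C D) n m e :
  is_chosen l n -> is_chosen l m -> is_chosen l (comp n m e).
Proof.
move=> /is_chosenE Hn /is_chosenE Hm; rewrite compE Hn Hm -e {1}Hm.
rewrite -tlift_comp; try cs.
apply: tlift_chosen; cs.
Qed.

Definition chosen_lifts (C D : Category) (l : DeltaLens C D) : Category :=
  wide_subcategory (@id_chosen C D l) (@comp_chosen C D l).

Definition chosen_incl (C D : Category) (l : DeltaLens C D) :
  Functor (chosen_lifts l) C.
Proof.
refine {| fob := fun c : chosen_lifts l => c : C;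
          fmor := fun m : Mor (chosen_lifts l) => proj1_sig m |} => //.
by move=> g f e e' /=; f_equal; apply: proof_irrelevance.
Defined.

(* The pullback of the retraction along the inclusion of the discrete category,
   that is, the coproduct of the fibres of the retraction. *)
Definition fibres (A B : Category) (c : SplitCoreflection A B) : Category :=
  pullback (cor_retr c) (discrete_incl A).

Definition fibres_proj (A B : Category) (c : SplitCoreflection A B) :
  Functor (fibres c) B := pullback_fst (cor_retr c) (discrete_incl A).

Lemma fibres_sec_eq (A B : Category) (c : SplitCoreflection A B) :
  cor_retr c \o (cor_fun c \o discrete_incl A) =
  discrete_incl A \o fun_id (discrete A).
Proof. by rewrite fun_compA retr_fun fun_idl fun_idr. Qed.

(* The functor sending [a] to [cor_fun c a] in the fibre over [a]. *)
Definition fibres_sec (A B : Category) (c : SplitCoreflection A B) :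
  Functor (discrete A) (fibres c) := pullback_pair (fibres_sec_eq c).

(* [h'] and [ell] are determined by the equations on them: [chosen_incl l] is
   monic, [fibres_sec c] is initial and [l \o chosen_incl l] is a discrete
   opfibration. *)
Definition is_canonical_lift (A B C D : Category)
    (c : TwistedCoreflection A B) (l : DeltaLens C D)
    (h : Functor A C) (k : Functor B D) (j : Functor B C) : Prop :=
  exists (h' : Functor (discrete A) (chosen_lifts l))
         (ell : Functor (fibres c) (chosen_lifts l)),
    chosen_incl l \o h' = h \o discrete_incl A /\
    ell \o fibres_sec c = h' /\
    l \o chosen_incl l \o ell = k \o fibres_proj c /\
    j \o cor_fun c = h /\
    j \o fibres_proj c = chosen_incl l \o ell.

Lemma chosen_factor (C D E : Category) (l : DeltaLens C D) (F : Functor E C) :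
  (forall m, is_chosen l (fmor F m)) ->
  exists G, chosen_incl l \o G = F.
Proof.
move=> H; unshelve eexists.
{ refine {| fob := fun a => F a : chosen_lifts l;
    fmor := fun m => exist _ (fmor F m) (H m) : Mor (chosen_lifts l) |}.
  - by move=> m; rewrite /= fmor_dom.
  - by move=> m; rewrite /= fmor_cod.
  - by move=> a; apply: sig_eq; rewrite /= fmor_id.
  - by move=> g f e e'; apply: sig_eq; apply: fmor_comp. }
exact: functor_ext.
Qed.

Lemma chosen_incl_mono (C D E : Category) (l : DeltaLens C D)
    (F G : Functor E (chosen_lifts l)) :
  chosen_incl l \o F = chosen_incl l \o G -> F = G.
Proof.
move=> H; apply: functor_ext => m; apply: sig_eq; exact: (fmor_eq H m).
Qed.

Lemma twist_or_identity (A B : Category) (c : TwistedCoreflection A B) m :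
  is_identity (fmor (cor_retr c) m) \/ exists w, is_twist c m w.
Proof.
case: (classic (is_identity (fmor (cor_retr c) m))) => [|N]; [by left|right].
by case: (tw_twist N) => w [Hw _]; exists w.
Qed.

Lemma counit_vertical (A B : Category) (c : SplitCoreflection A B) x :
  is_identity (fmor (cor_retr c) (counit c x)).
Proof. by rewrite retr_counit; exists (cor_retr c x). Qed.

Lemma twist_vertical (A B : Category) (c : SplitCoreflection A B) u w :
  is_twist c u w -> is_identity (fmor (cor_retr c) w).
Proof. by move=> /is_twist_retr ->; exists (cor_retr c (dom u)). Qed.

Lemma canonical_liftE (A B C D : Category)
    (c : TwistedCoreflection A B) (l : DeltaLens C D) h k j :
  l \o h = k \o cor_fun c ->
  is_canonical_lift c l h k j <->
  j \o cor_fun c = h /\ l \o j = k /\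
  forall m, is_identity (fmor (cor_retr c) m) -> is_chosen l (fmor j m).
Proof.
move=> E; split.
- move=> [h' [ell [E1 [E2 [E3 [E4 E5]]]]]].
  have V m : is_identity (fmor (cor_retr c) m) ->
      is_chosen l (fmor j m) /\ fmor l (fmor j m) = fmor k m.
    case=> a Ha; pose x : Mor (fibres c) := exist _ (m, a) Ha.
    have /= E5x := fmor_eq E5 x; have /= E3x := fmor_eq E3 x.
    rewrite E5x; split=> //; exact: (proj2_sig (fmor ell x)).
  split=> //; split; last by move=> m /V [].
  apply: functor_ext => m /=.
  case: (twist_or_identity c m) => [/V []//|[w Hw]].
  have [_ V1] := V _ (counit_vertical c (cod m)).
  have [_ V2] := V _ (twist_vertical Hw).
  have cw := is_twist_cod Hw.
  rewrite (is_twist_eq Hw).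
  do 6! (rewrite fmor_tcomp; last by cs).
  rewrite V1 V2; f_equal; f_equal.
  have /= -> := fmor_eq E4 (fmor (cor_retr c) m).
  exact: (fmor_eq E).
- move=> [E4 [Ek V]].
  have Hj m : is_chosen l (fmor (j \o fibres_proj c) m).
    by case: m => [[m a] e]; apply: V; exists a.
  have [ell Hell] := chosen_factor Hj.
  exists (ell \o fibres_sec c), ell; split; last split=> //; last split=> //.
  + rewrite fun_compA Hell -E4 -!fun_compA; f_equal; exact: functor_ext.
  + by rewrite -fun_compA Hell fun_compA Ek.
Qed.

Lemma canonical_lift_unique (A B C D : Category)
    (c : TwistedCoreflection A B) (l : DeltaLens C D) h k j j' :
  l \o h = k \o cor_fun c ->
  is_canonical_lift c l h k j -> is_canonical_lift c l h k j' -> j = j'.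
Proof.
move=> E /(canonical_liftE _ E) [F1 [K1 V1]] /(canonical_liftE _ E) [F2 [K2 V2]].
have Hc x : fmor j (counit c x) = fmor j' (counit c x).
  rewrite (is_chosenE (V1 _ (counit_vertical c x))).
  rewrite (is_chosenE (V2 _ (counit_vertical c x))).
  have /= -> := fmor_eq K1 (counit c x); have /= -> := fmor_eq K2 (counit c x).
  rewrite !fmor_dom counit_dom.
  have /= -> := fob_eq F1 (cor_retr c x).
  by have /= -> := fob_eq F2 (cor_retr c x).
have Ho x : j x = j' x.
  by have := f_equal (@cod C) (Hc x); rewrite !fmor_cod counit_cod.
have Hv m : is_identity (fmor (cor_retr c) m) -> fmor j m = fmor j' m.
  move=> I; rewrite (is_chosenE (V1 _ I)) (is_chosenE (V2 _ I)).
  have /= -> := fmor_eq K1 m; have /= -> := fmor_eq K2 m.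
  by rewrite !fmor_dom Ho.
apply: functor_ext => m.
case: (twist_or_identity c m) => [/Hv//|[w Hw]].
have cw := is_twist_cod Hw.
rewrite (is_twist_eq Hw).
do 4! (rewrite fmor_tcomp; last by cs).
rewrite (Hv _ (counit_vertical c (cod m))) (Hv _ (twist_vertical Hw)).
have /= -> := fmor_eq F1 (fmor (cor_retr c) m).
by have /= -> := fmor_eq F2 (fmor (cor_retr c) m).
Qed.

Section CanonicalLiftExists.
Variables (A B C D : Category).
Variables (c : TwistedCoreflection A B) (l : DeltaLens C D).
Variables (h : Functor A C) (k : Functor B D).
Hypothesis E : l \o h = k \o cor_fun c.
Local Notation f := (cor_fun c).
Local Notation q := (cor_retr c).

Let J x := cod (tlift l (h (q x)) (fmor k (counit c x))).
Let L m := tlift l (J (dom m)) (fmor k m).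

Lemma cl_E a : l (h a) = k (f a).
Proof. exact: (fob_eq E a). Qed.

Lemma cl_dom_counit x : dom (fmor k (counit c x)) = l (h (q x)).
Proof. by rewrite cl_E; cs. Qed.

Lemma cl_J x : l (J x) = k x.
Proof. by rewrite /J cod_tlift ?cl_dom_counit //; cs. Qed.

Lemma cl_J_fun a : J (f a) = h a.
Proof.
rewrite /J counit_fun fmor_id tlift_id; last by rewrite cl_E retr_fob.
by cs.
Qed.

Lemma cl_dom_L m : dom (L m) = J (dom m).
Proof. by rewrite /L; cs. Qed.

Lemma cl_L_pre m : dom (fmor k m) = l (J (dom m)).
Proof. by rewrite cl_J fmor_dom. Qed.

Lemma cl_L_over m : fmor l (L m) = fmor k m.
Proof. by rewrite /L tlift_over // cl_L_pre. Qed.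

Lemma cl_cod_L m : is_identity (fmor q m) -> cod (L m) = J (cod m).
Proof.
move=> I; have Eq := identityE I; have Ec := identity_cod I.
rewrite !fmor_cod !fmor_dom in Eq Ec.
have := f_equal (fun n => cod (tlift l (h (q (dom m))) (fmor k n)))
  (counit_nat c m).
rewrite Eq fmor_id tcomp_idr; last by cs.
rewrite /= fmor_tcomp; last by cs.
rewrite tlift_comp ?cl_dom_counit //; last by cs.
rewrite cod_tcomp; last by cs.
by rewrite /L /J Ec.
Qed.

Lemma cl_L_id x : L (id x) = id (J x).
Proof. by rewrite /L dom_id fmor_id tlift_id // cl_J. Qed.

Lemma cl_L_comp n m : is_identity (fmor q m) -> cod m = dom n ->
  L (n ** m) = L n ** L m.
Proof.
move=> I e; rewrite {1}/L fmor_tcomp // dom_tcomp //.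
rewrite tlift_comp; [|exact: cl_L_pre|by cs].
by rewrite -/(L m) cl_cod_L // e.
Qed.

Lemma cl_L_counit_dom x : dom (L (counit c x)) = h (q x).
Proof. by rewrite cl_dom_L counit_dom cl_J_fun. Qed.

Lemma cl_L_counit_cod x : cod (L (counit c x)) = J x.
Proof. by rewrite cl_cod_L ?counit_cod //; apply: counit_vertical. Qed.

Let tw u := match excluded_middle_informative (exists w, is_twist c u w) with
  | left H => proj1_sig (constructive_indefinite_description _ H)
  | right _ => u
  end.

Lemma cl_tw u : ~ is_identity (fmor q u) -> is_twist c u (tw u).
Proof.
move=> H; rewrite /tw; case: excluded_middle_informative => [H'|[]].
  by case: constructive_indefinite_description.
by case: (tw_twist H) => w [Hw _]; exists w.
Qed.

Let M u := match excluded_middle_informative (is_identity (fmor q u)) with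
  | left _ => L u
  | right _ => L (counit c (cod u)) ** (fmor h (fmor q u) ** L (tw u))
  end.

Lemma cl_M_vertical u : is_identity (fmor q u) -> M u = L u.
Proof. by rewrite /M; case: excluded_middle_informative. Qed.

Lemma cl_M_twist u w : ~ is_identity (fmor q u) -> is_twist c u w ->
  M u = L (counit c (cod u)) ** (fmor h (fmor q u) ** L w).
Proof.
move=> N H; rewrite /M; case: excluded_middle_informative => // ?.
by rewrite (twist_unique N (cl_tw N) H).
Qed.

Lemma cl_L_tw_dom u w : is_twist c u w -> dom (L w) = J (dom u).
Proof. by move=> H; rewrite cl_dom_L (is_twist_dom H). Qed.

Lemma cl_L_tw_cod u w : is_twist c u w -> cod (L w) = h (q (dom u)).
Proof.
move=> H; rewrite cl_cod_L; last exact: twist_vertical H.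
by rewrite (is_twist_cod H) cl_J_fun.
Qed.

Ltac cl := repeat (progress (rewrite ?cl_L_counit_dom ?cl_L_counit_cod
    ?fmor_dom ?fmor_cod /=)
  || (rewrite dom_tcomp; [|solve [cl]])
  || (rewrite cod_tcomp; [|solve [cl]])
  || match goal with H : is_twist _ _ _ |- _ =>
       rewrite (cl_L_tw_dom H) || rewrite (cl_L_tw_cod H) end);
  (done || congruence).

Lemma cl_M_dom u : dom (M u) = J (dom u).
Proof.
case: (classic (is_identity (fmor q u))) => [I|N].
  by rewrite cl_M_vertical // cl_dom_L.
have H := cl_tw N; rewrite (cl_M_twist N H); cl.
Qed.

Lemma cl_M_cod u : cod (M u) = J (cod u).
Proof.
case: (classic (is_identity (fmor q u))) => [I|N].
  by rewrite cl_M_vertical // cl_cod_L.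
have H := cl_tw N; rewrite (cl_M_twist N H); cl.
Qed.

Lemma cl_M_id x : M (id x) = id (J x).
Proof.
rewrite cl_M_vertical ?cl_L_id //.
by rewrite fmor_id; exists (q x).
Qed.

Lemma is_twist_vertical_r v u w : is_twist c v w ->
  is_identity (fmor q u) -> cod u = dom v -> is_twist c (v ** u) (w ** u).
Proof.
move=> H I e; have dw := is_twist_dom H; have cw := is_twist_cod H.
have Ew := is_twist_eq H; have Cw := is_twist_counit H.
have Eq := identityE I; have Ec := identity_cod I.
rewrite !fmor_cod !fmor_dom in Eq Ec.
apply/is_twistE; split; first by cs.
split; first by rewrite cod_tcomp ?dom_tcomp //; congruence.
split.
- rewrite dom_tcomp // -tcompA; try cs.
  rewrite counit_nat Eq fmor_id tcomp_idr; last by cs.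
  by rewrite e Cw; congruence.
- rewrite cod_tcomp // fmor_tcomp // Eq tcomp_idr; last by cs.
  by rewrite {1}Ew !tcompA //; cs.
Qed.

Lemma is_twist_vertical_l v u w : is_twist c u w ->
  is_identity (fmor q v) -> cod u = dom v -> is_twist c (v ** u) w.
Proof.
move=> H I e; have dw := is_twist_dom H; have cw := is_twist_cod H.
have Ew := is_twist_eq H; have Cw := is_twist_counit H.
have Eq := identityE I; have Ec := identity_cod I.
rewrite !fmor_cod !fmor_dom in Eq Ec.
apply/is_twistE; rewrite dom_tcomp // cod_tcomp // fmor_tcomp //.
rewrite Eq tcomp_idl; last by cs.
do 3! split=> //.
rewrite {1}Ew e tcompA; try cs.
rewrite counit_nat Eq fmor_id tcomp_idr; last by cs.
rewrite tcompA //; cs.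
Qed.

Lemma is_twist_comp v u w w' : is_twist c u w -> is_twist c v w' ->
  cod u = dom v -> is_twist c (v ** u) w.
Proof.
move=> H H' e; have dw := is_twist_dom H; have cw := is_twist_cod H.
have Ew := is_twist_eq H; have Cw := is_twist_counit H.
have dw' := is_twist_dom H'; have cw' := is_twist_cod H'.
have Ew' := is_twist_eq H'; have Cw' := is_twist_counit H'.
apply/is_twistE; rewrite dom_tcomp // cod_tcomp // fmor_tcomp //.
do 3! split=> //.
rewrite {1}Ew {1}Ew' -!tcompA; try cs.
rewrite (tcompA (h := w')); try cs.
rewrite e Cw' tcomp_idl; last by cs.
rewrite fmor_tcomp; last by cs.
rewrite -tcompA //; cs.
Qed.

Lemma cl_M_comp v u : cod u = dom v -> M (v ** u) = M v ** M u.
Proof.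
move=> e.
case: (classic (is_identity (fmor q u))) => [Iu|Nu];
  case: (classic (is_identity (fmor q v))) => [Iv|Nv].
- rewrite !cl_M_vertical ?cl_L_comp //.
  by rewrite fmor_tcomp // (identityE Iu) tcomp_idr // -(identity_cod Iu); cs.
- have H := cl_tw Nv; have H' := is_twist_vertical_r H Iu e.
  have Eq : fmor q (v ** u) = fmor q v.
    by rewrite fmor_tcomp // (identityE Iu) tcomp_idr // -(identity_cod Iu); cs.
  have N : ~ is_identity (fmor q (v ** u)) by rewrite Eq.
  rewrite (cl_M_twist N H') (cl_M_twist Nv H) (cl_M_vertical Iu) Eq.
  rewrite cod_tcomp // cl_L_comp //; last by rewrite (is_twist_dom H).
  have dL := cl_dom_L u; have cL := cl_cod_L Iu.
  rewrite !tcompA //; cl.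
- have H := cl_tw Nu; have H' := is_twist_vertical_l H Iv e.
  have Eq : fmor q (v ** u) = fmor q u.
    rewrite fmor_tcomp // (identityE Iv) tcomp_idl //; cs.
  have N : ~ is_identity (fmor q (v ** u)) by rewrite Eq.
  rewrite (cl_M_twist N H') (cl_M_twist Nu H) (cl_M_vertical Iv) Eq.
  have -> : L (counit c (cod (v ** u))) = L v ** L (counit c (cod u)).
    have Ev := identityE Iv; have Ec := identity_cod Iv.
    rewrite !fmor_cod !fmor_dom in Ev Ec.
    rewrite cod_tcomp // -cl_L_comp; [|exact: counit_vertical|cs].
    rewrite e counit_nat Ev fmor_id tcomp_idr //; cs.
  have dL := cl_dom_L v.
  by rewrite !tcompA //; cl.
- have H := cl_tw Nu; have H' := cl_tw Nv.
  have H2 := is_twist_comp H H' e.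
  rewrite (cl_M_twist Nu H) (cl_M_twist Nv H').
  have -> : L (counit c (cod v)) ** (fmor h (fmor q v) ** L (tw v)) **
      (L (counit c (cod u)) ** (fmor h (fmor q u) ** L (tw u))) =
      L (counit c (cod v)) ** (fmor h (fmor q (v ** u)) ** L (tw u)).
    rewrite -!tcompA; try cl.
    rewrite (tcompA (h := L (tw v))); try cl.
    rewrite -cl_L_comp; [|exact: counit_vertical|]; last first.
      by rewrite (is_twist_dom H'); cs.
    rewrite e (is_twist_counit H') cl_L_id cl_J_fun tcomp_idl; last by cl.
    rewrite fmor_tcomp // fmor_tcomp; last by cs.
    by rewrite -tcompA //; cl.
  case: (classic (is_identity (fmor q (v ** u)))) => [I|N].
  + rewrite (cl_M_vertical I) {1}(is_twist_eq H2).
    have Ev := identityE I; have Ec := identity_cod I.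
    have dw := is_twist_dom H2; have cw := is_twist_cod H2.
    rewrite !fmor_cod !fmor_dom in Ev Ec.
    rewrite Ev !fmor_id tcomp_idl; last by cs.
    rewrite tcomp_idl; last by rewrite dom_tcomp //; cl.
    rewrite cl_L_comp; [|exact: twist_vertical H2|]; last by rewrite cw counit_dom Ec.
    by rewrite cod_tcomp.
  + by rewrite (cl_M_twist N H2) cod_tcomp.
Qed.

Lemma canonical_lift_exists : exists j, is_canonical_lift c l h k j.
Proof.
unshelve eexists.
{ refine {| fob := J; fmor := M |}.
  - exact: cl_M_dom.
  - exact: cl_M_cod.
  - exact: cl_M_id.
  - by move=> v u e e'; rewrite !compE; apply: cl_M_comp. }
apply/(canonical_liftE _ E); split; last split.
- apply: functor_ext => m /=.
  case: (classic (is_identity (fmor q (fmor f m)))) => [I|N].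
    rewrite cl_M_vertical //; move: I; rewrite retr_fmor => - [a ->].
    by rewrite !fmor_id cl_L_id cl_J_fun.
  have H := cl_tw N; have := is_twist_counit H.
  rewrite (cl_M_twist N H) fmor_dom counit_fun retr_fob.
  have dw := is_twist_dom H; rewrite fmor_dom in dw.
  rewrite tcomp_idr; last by cs.
  move=> ->; rewrite fmor_cod counit_fun !cl_L_id !cl_J_fun retr_fmor.
  rewrite tcomp_idr; last by cs.
  by rewrite tcomp_idl //; cs.
- apply: functor_ext => u /=.
  case: (classic (is_identity (fmor q u))) => [I|N].
    by rewrite cl_M_vertical // cl_L_over.
  have H := cl_tw N; rewrite (cl_M_twist N H).
  do 2! (rewrite fmor_tcomp; last by cl).
  rewrite !cl_L_over {4}(is_twist_eq H).
  have cw := is_twist_cod H.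
  do 2! (rewrite fmor_tcomp; last by cs).
  by have /= -> := fmor_eq E (fmor q u).
- move=> m I /=; rewrite cl_M_vertical //.
  by apply: tlift_chosen; rewrite cl_L_pre.
Qed.

End CanonicalLiftExists.

Lemma canonical_lift_exists_unique (A B C D : Category)
    (c : TwistedCoreflection A B) (l : DeltaLens C D)
    (h : Functor A C) (k : Functor B D) :
  l \o h = k \o cor_fun c -> exists! j, is_canonical_lift c l h k j.
Proof.
move=> E; have [j Hj] := canonical_lift_exists E.
by exists j; split=> // j'; apply: canonical_lift_unique.
Qed.

Definition canonical_lift (A B C D : Category)
    (c : TwistedCoreflection A B) (l : DeltaLens C D)
    (h : Functor A C) (k : Functor B D) (e : l \o h = k \o cor_fun c) :
    Functor B C :=
  proj1_sig (constructive_definite_description _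
    (canonical_lift_exists_unique e)).

Lemma canonical_liftP (A B C D : Category)
    (c : TwistedCoreflection A B) (l : DeltaLens C D)
    (h : Functor A C) (k : Functor B D) (e : l \o h = k \o cor_fun c) :
  is_canonical_lift c l h k (canonical_lift e).
Proof. exact: (proj2_sig (constructive_definite_description _ _)). Qed.

Lemma canonical_lift_eq (A B C D : Category)
    (c : TwistedCoreflection A B) (l : DeltaLens C D)
    (h : Functor A C) (k : Functor B D) (e : l \o h = k \o cor_fun c) j :
  j \o cor_fun c = h -> l \o j = k ->
  (forall m, is_identity (fmor (cor_retr c) m) -> is_chosen l (fmor j m)) ->
  j = canonical_lift e.
Proof.
move=> H1 H2 H3; apply: (canonical_lift_unique e _ (canonical_liftP e)).
exact/(canonical_liftE _ e).
Qed.

Lemma canonical_lift_upper (A B C D : Category)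
    (c : TwistedCoreflection A B) (l : DeltaLens C D)
    (h : Functor A C) (k : Functor B D) (e : l \o h = k \o cor_fun c) :
  canonical_lift e \o cor_fun c = h.
Proof. by case: (proj1 (canonical_liftE _ e) (canonical_liftP e)). Qed.

Lemma canonical_lift_lower (A B C D : Category)
    (c : TwistedCoreflection A B) (l : DeltaLens C D)
    (h : Functor A C) (k : Functor B D) (e : l \o h = k \o cor_fun c) :
  l \o canonical_lift e = k.
Proof. by case: (proj1 (canonical_liftE _ e) (canonical_liftP e)) => _ []. Qed.

Lemma canonical_lift_chosen (A B C D : Category)
    (c : TwistedCoreflection A B) (l : DeltaLens C D)
    (h : Functor A C) (k : Functor B D) (e : l \o h = k \o cor_fun c) m :
  is_identity (fmor (cor_retr c) m) -> is_chosen l (fmor (canonical_lift e) m).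
Proof.
by case: (proj1 (canonical_liftE _ e) (canonical_liftP e)) => _ [_]; apply.
Qed.

Lemma lens_cell_chosen (A B C D : Category) (l : DeltaLens A C)
    (m : DeltaLens B D) h k u :
  lens_cell l m h k -> is_chosen l u -> is_chosen m (fmor h u).
Proof.
move=> H /is_chosenE ->; have /= E := fob_eq (proj1 H) (dom u).
rewrite (lens_cell_tlift H); last by cs.
by apply: tlift_chosen; rewrite E; cs.
Qed.

Definition canonical_ll (A B : Category) (c : TwistedCoreflection A B) :
  LeftLifting A B.
Proof.
refine {| ll_fun := cor_fun c;
  ll_lift := fun C D k s t e => @canonical_lift A B C D c k s t e |}.
- by move=> *; apply: canonical_lift_upper.
- by move=> *; apply: canonical_lift_lower.
- move=> C D C' D' k k' r0 r1 s t e e' H; apply: canonical_lift_eq.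
  + by rewrite -fun_compA canonical_lift_upper.
  + by rewrite fun_compA (proj1 H) -fun_compA canonical_lift_lower.
  + move=> m I; apply: (lens_cell_chosen H); exact: canonical_lift_chosen.
- move=> C D E k l s t e e1 e2; symmetry; apply: canonical_lift_eq.
  + exact: canonical_lift_upper.
  + by rewrite /= -fun_compA !canonical_lift_lower.
  + move=> m I; have H1 := canonical_lift_chosen e2 I.
    have H2 := canonical_lift_chosen e1 I.
    have E1 := fmor_eq (canonical_lift_lower e2) m.
    rewrite (is_chosenE H1).
    have /= E1' := fmor_eq (canonical_lift_lower e2) m.
    rewrite E1' (is_chosenE H2).
    have E2 : dom (fmor (canonical_lift e1) m) =
              k (dom (fmor (canonical_lift e2) m)).
      by rewrite -E1' fmor_dom.
    rewrite E2 -lens_comp_tlift; last by rewrite -E2; cs.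
    by apply: tlift_chosen; rewrite /= -E2; cs.
Defined.

Lemma canonical_lift_comp (A B C X Y : Category) (d : TwistedCoreflection B C)
    (c : TwistedCoreflection A B) (l : DeltaLens X Y)
    (s : Functor A X) (t : Functor C Y)
    (e : l \o s = t \o cor_fun (twisted_comp d c))
    (e1 : l \o s = t \o cor_fun d \o cor_fun c)
    (e2 : l \o canonical_lift e1 = t \o cor_fun d) :
  canonical_lift e2 = canonical_lift e.
Proof.
apply: canonical_lift_eq.
- by rewrite /= fun_compA !canonical_lift_upper.
- exact: canonical_lift_lower.
- move=> m /= I; case: (twist_or_identity d m) => [|[w Hw]].
    exact: canonical_lift_chosen.
  have cw := is_twist_cod Hw; rewrite (is_twist_eq Hw).
  set j := canonical_lift e2.
  have y2 : cod (fmor j w) =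
      dom (fmor j (fmor (cor_fun d) (fmor (cor_retr d) m))) by cs.
  have y1 : cod (comp _ _ y2) = dom (fmor j (counit d (cod m)))
    by rewrite compE; cs.
  rewrite fmor_tcomp; last by cs.
  rewrite fmor_tcomp; last by cs.
  rewrite -(compE y2) -(compE y1); apply: comp_chosen; last apply: comp_chosen.
  + apply: canonical_lift_chosen; exact: counit_vertical.
  + have /= -> := fmor_eq (canonical_lift_upper e2) (fmor (cor_retr d) m).
    exact: canonical_lift_chosen.
  + apply: canonical_lift_chosen; exact: twist_vertical Hw.
Qed.

Definition canonical_double_functor : DoubleFunctor TwCoref LLPLens.
Proof.
refine {| df_ob := fun A : TwCoref => A : LLPLens;
  df_hor := fun A B (h : @hor TwCoref A B) => h : @hor LLPLens A B;
  df_ver := fun A B (c : @ver TwCoref A B) => canonical_ll c |} => //=.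
- move=> A; apply: ll_ext => [//|C D k s t e e' /=].
  symmetry; apply: canonical_lift_eq; first exact: fun_idr.
    by move: (e'); rewrite /= fun_idr.
  by move=> m /= [a ->]; rewrite fmor_id; apply: id_chosen.
- move=> A B C d c; apply: ll_ext => [//|X Y k s t e e' /=].
  symmetry; exact: canonical_lift_comp.
- move=> A B C C' f g h k [H1 [H2 H3]]; split=> // X Y l s t e e' /=.
  apply: canonical_lift_eq.
  + by rewrite -fun_compA H1 fun_compA canonical_lift_upper.
  + by rewrite fun_compA canonical_lift_lower.
  + move=> m I /=; apply: canonical_lift_chosen.
    have /= <- := fmor_eq H2 m; exact: fmor_identity.
Defined.

(* Main.v *)
From Corelib Require Import ssreflect.
From Stdlib Require Import FunctionalExtensionality ProofIrrelevance.
From Stdlib Require Import Classical ClassicalEpsilon.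
Require Import Defs.

(** The vertical morphisms of the two double categories are in bijection because
    a functor [F : A -> B] is classified by one universal delta lens.

    Every functor [F : A -> B] factors as [A -L-> free_cat F -R-> B], where [R]
    is the free delta lens on [F].  The objects over [b] are the morphisms
    [u : F a -> b], to be thought of as the codomain of a formal lift of [u] at
    [a]; the morphisms are the formal composites of such lifts and of morphisms
    of [A].  A reduced composite out of [u : F a -> b] is either a single lift,
    or a lift along a retraction of [u], which leads back to [a], followed by a
    non-identity morphism of [A] and one more lift.  These are the two cases in
    the definition of a twisted coreflection, and indeed [L] is a twisted
    coreflection ([free_coref]).  Its canonical lifts extend every square from
    [F] to a delta lens [l] to a cell [R -> l], so that a natural choice of
    lifts for [F] is determined by the lift of [L] and the identity of [B]
    against [R], a section [S] of [R] under [A] ([ll_lift_section]).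

    The section [S] is the twisted coreflection, read componentwise: [S x] is a
    pair of an object [q x] and a morphism [F (q x) -> x], the counit, while
    [S m], when [q m] is not an identity, is given by the twist of [m].  That
    [S] is a functor and a section of [R] gives naturality of the counit and
    existence of twists.  It does not give that [S] preserves counits, that is,
    that [q] sends them to identities; this comes from the compatibility of the
    lifts with composition of delta lenses, applied to [R] and to the free delta
    lens on [L] ([ll_section_counit]).  Then [S] also preserves twists, so that
    these are unique because they are for [L].

    Starting from a twisted coreflection, [S] is its canonical lift against [R],
    from which its data are recovered ([ll_coref_canonical]).  Starting from a
    left lifting, its lifts are composites of [S] with canonical lifts, hence
    send the morphisms over identities of [A] to chosen lifts and so are
    canonical ([canonical_ll_coref]).  Cells correspond since compatibility with
    the lifts against the free lens on the target compares retractions and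
    counits ([ll_coref_cell]).  Compatibility of the inverse with vertical units
    and composites follows from bijectivity. *)

Set Implicit Arguments.
Unset Strict Implicit.
Unset Printing Implicit Defensive.
Set SsrOldRewriteGoalsOrder.
Local Open Scope cat_scope.

(** * Identity morphisms *)

Definition if_identity {A : Category} {T : Type} (w : Mor A) (x y : T) : T :=
  if excluded_middle_informative (is_identity w) is left _ then x else y.

Lemma if_identityT (A : Category) (T : Type) (w : Mor A) (x y : T) :
  is_identity w -> if_identity w x y = x.
Proof. by rewrite /if_identity; case: excluded_middle_informative. Qed.

Lemma if_identityF (A : Category) (T : Type) (w : Mor A) (x y : T) :
  ~ is_identity w -> if_identity w x y = y.
Proof. by rewrite /if_identity; case: excluded_middle_informative. Qed.

Lemma tcomp_identity_l (A : Category) (n m : Mor A) :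
  cod m = dom n -> is_identity n -> n ** m = m.
Proof. by move=> e /identityE ->; rewrite tcomp_idl. Qed.

Lemma tcomp_identity_r (A : Category) (n m : Mor A) :
  cod m = dom n -> is_identity m -> n ** m = n.
Proof.
by move=> e I; rewrite (identityE I) tcomp_idr // -e (identity_cod I).
Qed.

(** * The free delta lens on a functor *)

Section FreeLens.
Variables (A B : Category) (F : Functor A B).

Record FreeOb := {
  fo_base : A;
  fo_arr : Mor B;
  fo_dom : dom fo_arr = F fo_base
}.

Lemma free_ob_ext (x y : FreeOb) :
  fo_base x = fo_base y -> fo_arr x = fo_arr y -> x = y.
Proof.
case: x y => [a u p] [b v q] /= E1 E2; subst; f_equal.
exact: proof_irrelevance.
Qed.

(** From [u : F a -> b] to [u' : F a' -> b'], a morphism is either a formal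
    lift, when its base is an identity, or the formal lift of a retraction of
    [u], then a non-identity base [a -> a'], then the formal lift of [u'].
    Storing only the first lift makes equality of morphisms componentwise in
    both cases. *)
Record FreeMor := {
  fm_src : FreeOb;
  fm_tgt : FreeOb;
  fm_base : Mor A;
  fm_arr : Mor B;
  fm_base_dom : dom fm_base = fo_base fm_src;
  fm_base_cod : cod fm_base = fo_base fm_tgt;
  fm_arr_dom : dom fm_arr = cod (fo_arr fm_src);
  fm_case :
    is_identity fm_base /\ fm_arr ** fo_arr fm_src = fo_arr fm_tgt \/
    ~ is_identity fm_base /\ fm_arr ** fo_arr fm_src = id (F (fo_base fm_src))
}.

Lemma free_mor_ext (m n : FreeMor) :
  fm_src m = fm_src n -> fm_tgt m = fm_tgt n ->
  fm_base m = fm_base n -> fm_arr m = fm_arr n -> m = n.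
Proof.
case: m n => [x y w r p1 p2 p3 p4] [x' y' w' r' q1 q2 q3 q4] /= E1 E2 E3 E4.
subst; f_equal; exact: proof_irrelevance.
Qed.

Lemma fm_vertical m : is_identity (fm_base m) ->
  fm_arr m ** fo_arr (fm_src m) = fo_arr (fm_tgt m).
Proof. by case: (fm_case m) => [[]//|[]]. Qed.

Lemma fm_twisted m : ~ is_identity (fm_base m) ->
  fm_arr m ** fo_arr (fm_src m) = id (F (fo_base (fm_src m))).
Proof. by case: (fm_case m) => [[]//|[]]. Qed.

Lemma fm_vertical_cod m : is_identity (fm_base m) ->
  cod (fm_arr m) = cod (fo_arr (fm_tgt m)).
Proof. by move/fm_vertical <-; rewrite cod_tcomp // fm_arr_dom. Qed.

Lemma fm_twisted_cod m : ~ is_identity (fm_base m) ->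
  cod (fm_arr m) = F (fo_base (fm_src m)).
Proof.
move/fm_twisted/(f_equal (@cod B)); rewrite cod_id cod_tcomp // fm_arr_dom //.
Qed.

Lemma fm_vertical_base m : is_identity (fm_base m) ->
  fo_base (fm_tgt m) = fo_base (fm_src m).
Proof. by move/identity_cod; rewrite fm_base_cod fm_base_dom. Qed.

Definition free_id_mor (x : FreeOb) : FreeMor.
Proof.
refine {| fm_src := x; fm_tgt := x; fm_base := id (fo_base x);
  fm_arr := id (cod (fo_arr x)) |}; try cs.
by left; rewrite tcomp_idl //; split=> //; apply: id_identity.
Defined.

(** If [m] is a formal lift, it composes with the first lift of [n].  Otherwise
    the last lift of [m] is absorbed by [n], being cancelled by the retraction
    if the base of [n] is not an identity.  The bases are then composed, and if
    this gives an identity, the last lift is no longer separated from the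
    retraction of [m]. *)
Definition free_comp_arr (n m : FreeMor) : Mor B :=
  if_identity (fm_base m) (fm_arr n ** fm_arr m)
    (if_identity (fm_base n ** fm_base m)
      (fo_arr (fm_tgt n) ** fm_arr m) (fm_arr m)).

Lemma fm_base_comp (n m : FreeMor) : fm_tgt m = fm_src n ->
  cod (fm_base m) = dom (fm_base n).
Proof. by rewrite fm_base_cod fm_base_dom => ->. Qed.

Lemma free_comp_arrV (n m : FreeMor) : is_identity (fm_base m) ->
  free_comp_arr n m = fm_arr n ** fm_arr m.
Proof. exact: if_identityT. Qed.

Lemma free_comp_arrT (n m : FreeMor) : ~ is_identity (fm_base m) ->
  free_comp_arr n m = if_identity (fm_base n ** fm_base m)
      (fo_arr (fm_tgt n) ** fm_arr m) (fm_arr m).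
Proof. exact: if_identityF. Qed.

Lemma fm_arr_comp (n m : FreeMor) : fm_tgt m = fm_src n ->
  is_identity (fm_base m) -> cod (fm_arr m) = dom (fm_arr n).
Proof. by move=> e I; rewrite (fm_vertical_cod I) fm_arr_dom e. Qed.

Lemma fo_arr_comp (n m : FreeMor) : fm_tgt m = fm_src n ->
  is_identity (fm_base n ** fm_base m) -> ~ is_identity (fm_base m) ->
  cod (fm_arr m) = dom (fo_arr (fm_tgt n)).
Proof.
move=> e I N; rewrite (fm_twisted_cod N) fo_dom -fm_base_cod -fm_base_dom.
have e' := fm_base_comp e.
by have := identity_cod I; rewrite cod_tcomp // dom_tcomp // => ->.
Qed.

Definition free_comp (n m : FreeMor) (e : fm_tgt m = fm_src n) : FreeMor.
Proof.
refine {| fm_src := fm_src m; fm_tgt := fm_tgt n;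
  fm_base := fm_base n ** fm_base m; fm_arr := free_comp_arr n m |}.
- by rewrite dom_tcomp; [exact: fm_base_dom | exact: fm_base_comp].
- by rewrite cod_tcomp; [exact: fm_base_cod | exact: fm_base_comp].
- case: (classic (is_identity (fm_base m))) => [I|N].
    rewrite free_comp_arrV // dom_tcomp; first exact: fm_arr_dom.
    exact: fm_arr_comp.
  rewrite free_comp_arrT //.
  case: (classic (is_identity (fm_base n ** fm_base m))) => [I|N'].
    rewrite if_identityT // dom_tcomp; first exact: fm_arr_dom.
    exact: fo_arr_comp.
  by rewrite if_identityF // fm_arr_dom.
- case: (classic (is_identity (fm_base m))) => [I|N].
    rewrite free_comp_arrV // -tcompA; last exact: fm_arr_comp.
      2: by rewrite fm_arr_dom.
    rewrite (fm_vertical I) e -(fm_vertical_base I) e tcomp_identity_r //.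
      exact: fm_case.
    exact: fm_base_comp.
  rewrite free_comp_arrT //.
  case: (classic (is_identity (fm_base n ** fm_base m))) => [I|N'].
    left; split=> //; rewrite if_identityT // -tcompA; last exact: fo_arr_comp.
      2: by rewrite fm_arr_dom.
    rewrite (fm_twisted N) tcomp_idr // -(fm_twisted_cod N); symmetry.
    exact: fo_arr_comp.
  by right; split=> //; rewrite if_identityF //; apply: fm_twisted.
Defined.

Lemma free_comp_idl x f (e : fm_tgt f = fm_src (free_id_mor x)) :
  free_comp e = f.
Proof.
have e0 : fm_tgt f = x by [].
have Eb : id (fo_base x) ** fm_base f = fm_base f.
  by rewrite tcomp_idl // fm_base_cod e0.
apply: free_mor_ext => //=.
case: (classic (is_identity (fm_base f))) => [I|N].
  by rewrite free_comp_arrV //= tcomp_idl // (fm_vertical_cod I) e0.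
by rewrite free_comp_arrT //= if_identityF //= Eb.
Qed.

Lemma free_comp_idr x f (e : fm_tgt (free_id_mor x) = fm_src f) :
  free_comp e = f.
Proof.
have e0 : x = fm_src f by []; apply: free_mor_ext => //=.
  by rewrite tcomp_idr // fm_base_dom e0.
rewrite free_comp_arrV /=; last exact: id_identity.
by rewrite tcomp_idr // fm_arr_dom e0.
Qed.

(** The only case which is not a matter of associativity in [B] is that of bases
    of [g] and [f] which are not identities but compose to one: there the
    composite of [g] and [f] ends with the lift to the target of [g], which [h]
    absorbs if its base is an identity and cancels otherwise. *)
Lemma free_comp_assoc (h g f : FreeMor) (e1 : fm_tgt f = fm_src g)
    (e2 : fm_tgt (free_comp e1) = fm_src h) (e3 : fm_tgt g = fm_src h)
    (e4 : fm_tgt f = fm_src (free_comp e3)) :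
  free_comp e2 = free_comp e4.
Proof.
have d1 := fm_base_comp e1; have d3 := fm_base_comp e3.
have EA := tcompA d1 d3.
apply: free_mor_ext => //=.
case: (classic (is_identity (fm_base f))) => [I|N].
  have Eg : fm_base g ** fm_base f = fm_base g by apply: tcomp_identity_r.
  rewrite (free_comp_arrV (free_comp e3) I) /=.
  have a1 := fm_arr_comp e1 I.
  case: (classic (is_identity (fm_base g))) => [Ig|Ng].
    rewrite free_comp_arrV /= ?Eg // !free_comp_arrV //.
    by rewrite tcompA //; apply: fm_arr_comp.
  rewrite free_comp_arrT /= ?Eg // (free_comp_arrV g I) free_comp_arrT //.
  case: (classic (is_identity (fm_base h ** fm_base g))) => [Ih|Nh].
    by rewrite !if_identityT // tcompA //; apply: fo_arr_comp.
  by rewrite !if_identityF.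
rewrite (free_comp_arrT (free_comp e3) N) /=.
case: (classic (is_identity (fm_base g ** fm_base f))) => [I|N'].
  have a1 := fo_arr_comp e1 I N.
  rewrite free_comp_arrV //= free_comp_arrT // if_identityT //.
  have Eh : fm_base h ** (fm_base g ** fm_base f) = fm_base h.
    by apply: tcomp_identity_r => //; rewrite cod_tcomp.
  rewrite -EA Eh tcompA //; last by rewrite fm_arr_dom e3.
  rewrite e3.
  case: (classic (is_identity (fm_base h))) => [Ih|Nh].
    by rewrite if_identityT // fm_vertical.
  rewrite if_identityF // fm_twisted // tcomp_idl //.
  by rewrite a1 e3 fo_dom.
rewrite free_comp_arrT //= EA free_comp_arrT //.
by rewrite (@if_identityF _ _ (fm_base g ** _)).
Qed.

Definition free_cat : Category.
Proof.
refine {| Ob := FreeOb; Mor := FreeMor; dom := fm_src; cod := fm_tgt;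
  id := free_id_mor; comp := free_comp |} => //.
- exact: free_comp_idl.
- exact: free_comp_idr.
- exact: free_comp_assoc.
Defined.

Lemma free_tcomp_base (n m : Mor free_cat) : cod m = dom n ->
  fm_base (n ** m) = fm_base n ** fm_base m.
Proof. by move=> e; rewrite -(compE e). Qed.

Lemma free_tcomp_arr (n m : Mor free_cat) : cod m = dom n ->
  fm_arr (n ** m) = free_comp_arr n m.
Proof. by move=> e; rewrite -(compE e). Qed.

Definition free_unit_ob (a : A) : FreeOb.
Proof. by refine {| fo_base := a; fo_arr := id (F a) |}; cs. Defined.

Definition free_unit_mor (w : Mor A) : FreeMor.
Proof.
refine {| fm_src := free_unit_ob (dom w); fm_tgt := free_unit_ob (cod w);
  fm_base := w; fm_arr := id (F (dom w)) |} => /=; try cs.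
rewrite tcomp_idl; try cs.
case: (classic (is_identity w)) => [I|N]; last by right.
by left; rewrite (identity_cod I).
Defined.

Definition free_unit : Functor A free_cat.
Proof.
refine {| fob := free_unit_ob : A -> free_cat;
  fmor := free_unit_mor : Mor A -> Mor free_cat |} => //.
- move=> a; apply: free_mor_ext => //=; rewrite ?dom_id ?cod_id //.
- move=> g f e e'; rewrite compE; apply: free_mor_ext => //=.
  + by rewrite dom_tcomp.
  + by rewrite cod_tcomp.
  + rewrite /free_comp_arr /= dom_tcomp //.
    rewrite /if_identity; case: excluded_middle_informative => [I|N].
      by rewrite tcomp_idl // -e (identity_cod I); cs.
    case: excluded_middle_informative => // I.
    have := identity_cod I; rewrite cod_tcomp // dom_tcomp // => ->.
    by rewrite tcomp_idl //; cs.
Defined.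

Definition free_retr : Functor free_cat A.
Proof.
refine {| fob := fun x : free_cat => fo_base x;
  fmor := fun m : Mor free_cat => fm_base m |} => //.
- by move=> m; rewrite /= fm_base_dom.
- by move=> m; rewrite /= fm_base_cod.
- by move=> g f e e'; rewrite !compE free_tcomp_base.
Defined.

(** The formal composite, evaluated in [B]. *)
Definition free_proj_mor (m : FreeMor) : Mor B :=
  if_identity (fm_base m) (fm_arr m)
    (fo_arr (fm_tgt m) ** (fmor F (fm_base m) ** fm_arr m)).

Lemma free_proj_V m : is_identity (fm_base m) -> free_proj_mor m = fm_arr m.
Proof. exact: if_identityT. Qed.

Lemma free_proj_T m : ~ is_identity (fm_base m) ->
  free_proj_mor m = fo_arr (fm_tgt m) ** (fmor F (fm_base m) ** fm_arr m).
Proof. exact: if_identityF. Qed.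

Lemma free_twisted_comp1 m : ~ is_identity (fm_base m) ->
  cod (fm_arr m) = dom (fmor F (fm_base m)).
Proof. by move/fm_twisted_cod ->; rewrite fmor_dom fm_base_dom. Qed.

Lemma free_twisted_comp2 m :
  cod (fmor F (fm_base m)) = dom (fo_arr (fm_tgt m)).
Proof. by rewrite fmor_cod fo_dom fm_base_cod. Qed.

Lemma free_proj_dom m : dom (free_proj_mor m) = cod (fo_arr (fm_src m)).
Proof.
case: (classic (is_identity (fm_base m))) => [I|N].
  by rewrite free_proj_V // fm_arr_dom.
have e1 := free_twisted_comp1 N; have e2 := free_twisted_comp2 m.
have e3 : cod (fmor F (fm_base m) ** fm_arr m) = dom (fo_arr (fm_tgt m)).
  by rewrite cod_tcomp.
by rewrite free_proj_T // !dom_tcomp // fm_arr_dom.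
Qed.

Lemma free_proj_cod m : cod (free_proj_mor m) = cod (fo_arr (fm_tgt m)).
Proof.
case: (classic (is_identity (fm_base m))) => [I|N].
  by rewrite free_proj_V // fm_vertical_cod.
have e1 := free_twisted_comp1 N; have e2 := free_twisted_comp2 m.
have e3 : cod (fmor F (fm_base m) ** fm_arr m) = dom (fo_arr (fm_tgt m)).
  by rewrite cod_tcomp.
by rewrite free_proj_T // cod_tcomp.
Qed.

(** This square evaluates composites in which the first factor ends with a lift;
    pulled back along a section of the projection, it is naturality of a
    counit. *)
Lemma free_proj_nat m : free_proj_mor m ** fo_arr (fm_src m) =
  fo_arr (fm_tgt m) ** fmor F (fm_base m).
Proof.
have a := fm_arr_dom m; have u := fo_dom (fm_tgt m).
rewrite -fm_base_cod in u.
case: (classic (is_identity (fm_base m))) => [I|N].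
  rewrite free_proj_V // fm_vertical // tcomp_identity_r //; try cs.
  exact: fmor_identity.
have e1 := free_twisted_comp1 N; have e2 := free_twisted_comp2 m.
rewrite free_proj_T // (tcompA e1 e2) -tcompA //; last by rewrite dom_tcomp.
rewrite fm_twisted // tcomp_idr //.
by rewrite dom_tcomp // fmor_dom fm_base_dom.
Qed.

Lemma free_proj_comp (n m : Mor free_cat) : cod m = dom n ->
  free_proj_mor (n ** m) = free_proj_mor n ** free_proj_mor m.
Proof.
move=> e; have e0 : fm_tgt m = fm_src n by [].
have d := fm_base_comp e0.
have Eb := free_tcomp_base e; have Ea := free_tcomp_arr e.
have Ec : fm_tgt (n ** m) = fm_tgt n := cod_tcomp e.
have n2 := free_twisted_comp2 n.
case: (classic (is_identity (fm_base m))) => [I|N].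
  rewrite free_comp_arrV // in Ea; rewrite (tcomp_identity_r d I) in Eb.
  rewrite (free_proj_V I).
  case: (classic (is_identity (fm_base n))) => [In|Nn].
    by rewrite !free_proj_V ?Eb.
  have n1 := free_twisted_comp1 Nn; have a1 := fm_arr_comp e0 I.
  rewrite !free_proj_T ?Eb // Ea Ec (tcompA a1 n1) tcompA ?dom_tcomp //.
  by rewrite cod_tcomp.
have m1 := free_twisted_comp1 N; have m2 := free_twisted_comp2 m.
have c : cod (fo_arr (fm_tgt m)) = dom (free_proj_mor n).
  by rewrite free_proj_dom e0.
have f1 : cod (fmor F (fm_base m)) = dom (fmor F (fm_base n)).
  by rewrite fmor_cod fmor_dom d.
(* Whether or not the bases compose to an identity, the composite [n ** m]
   projects to this morphism. *)
have -> : free_proj_mor n ** free_proj_mor m =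
    fo_arr (fm_tgt n) ** (fmor F (fm_base n ** fm_base m) ** fm_arr m).
  rewrite (free_proj_T N) tcompA //; last by rewrite cod_tcomp.
  rewrite e0 free_proj_nat fmor_tcomp // -(tcompA m1 f1) -tcompA //.
  by rewrite cod_tcomp.
rewrite free_comp_arrT // in Ea.
case: (classic (is_identity (fm_base n ** fm_base m))) => [I|N'].
  have a1 := fo_arr_comp e0 I N.
  rewrite free_proj_V ?Eb // Ea if_identityT //.
  rewrite (tcomp_identity_l _ (fmor_identity F I)) //.
  by rewrite m1 fmor_tcomp // dom_tcomp.
by rewrite free_proj_T ?Eb // Ea if_identityF // Ec.
Qed.

Definition free_proj : Functor free_cat B.
Proof.
refine {| fob := fun x : free_cat => cod (fo_arr x);
  fmor := fun m : Mor free_cat => free_proj_mor m |}.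
- exact: free_proj_dom.
- exact: free_proj_cod.
- by move=> x; rewrite free_proj_V //=; apply: id_identity.
- by move=> g f e e'; rewrite !compE free_proj_comp.
Defined.

Definition free_push (x : FreeOb) (v : Mor B) (e : dom v = cod (fo_arr x)) :
  FreeOb.
Proof.
refine {| fo_base := fo_base x; fo_arr := v ** fo_arr x |}.
by rewrite dom_tcomp // fo_dom.
Defined.

Definition free_lift (x : FreeOb) (v : Mor B) (e : dom v = cod (fo_arr x)) :
  FreeMor.
Proof.
refine {| fm_src := x; fm_tgt := free_push e; fm_base := id (fo_base x);
  fm_arr := v |}; try cs.
by left; split=> //; apply: id_identity.
Defined.

Definition free_lens : DeltaLens free_cat B.
Proof.
refine {| lens_fun := free_proj;
  lift := fun (x : free_cat) v (e : dom v = free_proj x) =>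
    free_lift e : Mor free_cat |} => //.
- by move=> x v e; rewrite /= free_proj_V //; apply: id_identity.
- move=> x e; apply: free_mor_ext => //=; apply: free_ob_ext => //=.
  by rewrite tcomp_idl.
- move=> x u v e e1 e2 e3 e4; apply: free_mor_ext => //=.
  + by apply: free_ob_ext => //=; rewrite compE tcompA //.
  + by rewrite tcomp_idl //; cs.
  + by rewrite free_comp_arrV ?compE //; apply: id_identity.
Defined.

Lemma free_proj_unit : free_proj \o free_unit = F.
Proof.
apply: functor_ext => m /=.
case: (classic (is_identity m)) => [I|N].
  by rewrite free_proj_V //= {2}(identityE I) fmor_id.
by rewrite free_proj_T //= tcomp_idr ?tcomp_idl //; cs.
Qed.

Lemma free_retr_unit : free_retr \o free_unit = fun_id A.
Proof. exact: functor_ext. Qed.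

Lemma free_chosen_vertical (m : Mor free_cat) : is_chosen free_lens m ->
  is_identity (fmor free_retr m).
Proof. by case=> x [v [e ->]]; apply: id_identity. Qed.

Definition free_counit_mor (x : FreeOb) : FreeMor.
Proof.
refine {| fm_src := free_unit_ob (fo_base x); fm_tgt := x;
  fm_base := id (fo_base x); fm_arr := fo_arr x |} => /=; try cs.
- by rewrite cod_id fo_dom.
- by left; rewrite tcomp_idr ?fo_dom //; split=> //; apply: id_identity.
Defined.

Definition free_counit : NatTrans (free_unit \o free_retr) (fun_id free_cat).
Proof.
refine {| component := fun x : free_cat => free_counit_mor x : Mor free_cat |}
  => // m e e'.
apply: free_mor_ext => //=.
- by rewrite fm_base_dom.
- by rewrite tcomp_idl ?tcomp_idr ?fm_base_dom ?fm_base_cod.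
- rewrite free_comp_arrV /=; last exact: id_identity.
  case: (classic (is_identity (fm_base m))) => [I|N].
    rewrite free_comp_arrV //= fm_vertical // tcomp_idr // fo_dom.
    by rewrite fm_base_dom fm_vertical_base.
  rewrite free_comp_arrT //= if_identityF.
    by rewrite fm_twisted // fm_base_dom.
  by rewrite tcomp_idl // fm_base_cod.
Defined.

Definition free_split : SplitCoreflection A free_cat.
Proof.
refine {| cor_fun := free_unit; cor_retr := free_retr; counit := free_counit |}
  => //.
- exact: free_retr_unit.
- move=> a; apply: free_mor_ext => //=; rewrite cod_id //.
Defined.

(** A twist [w] lies over an identity, hence is a formal lift, and the factor of
    [m] following it has an identity as its first lift. *)
Lemma free_twist_arr (m w : Mor free_cat) : ~ is_identity (fm_base m) ->
  is_twist free_split m w -> fm_arr w = fm_arr m.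
Proof.
move=> N H; have E := is_twist_eq H; have R := is_twist_retr H.
rewrite /= in E R.
have cw := is_twist_cod H; rewrite /= in cw.
have I : is_identity (fm_base w) by rewrite R; apply: id_identity.
have e1 : @cod free_cat w = @dom free_cat (free_unit_mor (fm_base m)).
  by rewrite /= cw fm_base_dom.
have e2 : @cod free_cat (free_unit_mor (fm_base m)) =
    @dom free_cat (free_counit_mor (fm_tgt m)).
  by rewrite /= fm_base_cod.
rewrite (@tcompA free_cat _ _ _ e1 e2) in E.
rewrite E free_tcomp_arr; last by rewrite dom_tcomp.
rewrite free_comp_arrV // free_tcomp_arr // free_comp_arrT //=.
rewrite if_identityF; last by rewrite tcomp_idl // fm_base_cod.
rewrite tcomp_idl //.
by rewrite (fm_vertical_cod I) cw /= cod_id fm_base_dom.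
Qed.

Definition free_twist_mor (m : FreeMor) (N : ~ is_identity (fm_base m)) :
  FreeMor.
Proof.
refine {| fm_src := fm_src m; fm_tgt := free_unit_ob (fo_base (fm_src m));
  fm_base := id (fo_base (fm_src m)); fm_arr := fm_arr m |} => /=; try cs.
- exact: fm_arr_dom.
- by left; split; [exact: id_identity | exact: fm_twisted].
Defined.

Lemma free_twist (m : Mor free_cat) (N : ~ is_identity (fm_base m)) :
  is_twist free_split m (free_twist_mor N).
Proof.
split=> //; split=> //; split=> [e|e e'].
  apply: free_mor_ext => //=; first by rewrite tcomp_idl //; cs.
  rewrite free_comp_arrV /=; last exact: id_identity.
  by rewrite fm_twisted // cod_id.
apply: free_mor_ext => //=.
  by rewrite tcomp_idl ?fm_base_cod // tcomp_idr ?fm_base_dom.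
rewrite free_comp_arrV /=; last exact: id_identity.
rewrite free_comp_arrT //= if_identityF; last by rewrite tcomp_idl ?fm_base_cod.
by rewrite tcomp_idl // fm_twisted_cod // fm_base_dom.
Qed.

Definition free_coref : TwistedCoreflection A free_cat.
Proof.
refine {| tw_split := free_split |} => m N.
exists (free_twist_mor N); split; first exact: free_twist.
move=> w H; have cw := is_twist_cod H; have dw := is_twist_dom H.
apply: free_mor_ext => //=.
- by have /= -> := is_twist_retr H.
- by rewrite (free_twist_arr N H).
Defined.

(** By this description of the counit, [ll_section_counit] below says that the
    section of a left lifting preserves counits. *)
Lemma free_counit_lift (x : free_cat) :
  counit free_coref x = tlift free_lens (free_unit (fo_base x)) (fo_arr x).
Proof.
have e : dom (fo_arr x) = free_lens (free_unit (fo_base x)).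
  by rewrite /= fo_dom cod_id.
rewrite -(liftE e); apply: free_mor_ext => //=; apply: free_ob_ext => //=.
by rewrite tcomp_idr // fo_dom.
Qed.

Lemma free_lift_unit_dom (a : A) (v : Mor B) : dom v = F a ->
  dom v = free_lens (free_unit a).
Proof. by rewrite /= cod_id. Qed.

Lemma free_lift_unit_arr (a : A) (v : Mor B) : dom v = F a ->
  fo_arr (cod (tlift free_lens (free_unit a) v)) = v.
Proof.
by move=> e0; have e := free_lift_unit_dom e0; rewrite -(liftE e) /= tcomp_idr.
Qed.

End FreeLens.

(** * Canonical lifts *)

Lemma canonical_lift_counit (A B C D : Category)
    (c : TwistedCoreflection A B) (l : DeltaLens C D)
    (h : Functor A C) (k : Functor B D) (e : l \o h = k \o cor_fun c) x :
  fmor (canonical_lift e) (counit c x) =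
  tlift l (h (cor_retr c x)) (fmor k (counit c x)).
Proof.
rewrite (is_chosenE (canonical_lift_chosen e (counit_vertical c x))).
have /= -> := fmor_eq (canonical_lift_lower e) (counit c x).
rewrite fmor_dom counit_dom.
by have /= -> := fob_eq (canonical_lift_upper e) (cor_retr c x).
Qed.

Lemma canonical_lift_ob (A B C D : Category)
    (c : TwistedCoreflection A B) (l : DeltaLens C D)
    (h : Functor A C) (k : Functor B D) (e : l \o h = k \o cor_fun c) x :
  canonical_lift e x = cod (tlift l (h (cor_retr c x)) (fmor k (counit c x))).
Proof. by rewrite -canonical_lift_counit fmor_cod counit_cod. Qed.

(** The canonical lift sends all factors of a morphism [m], except for the image
    of [m] under the coreflection, to chosen lifts and so to identities under
    [p]. *)
Lemma canonical_lift_retr (A B C D X : Category)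
    (c : TwistedCoreflection A B) (l : DeltaLens C D)
    (h : Functor A C) (k : Functor B D) (e : l \o h = k \o cor_fun c)
    (p : Functor C X) :
  (forall m, is_chosen l m -> is_identity (fmor p m)) ->
  p \o canonical_lift e = p \o h \o cor_retr c.
Proof.
move=> P; set j := canonical_lift e.
have Hf m : fmor j (fmor (cor_fun c) m) = fmor h m.
  exact: (fmor_eq (canonical_lift_upper e) m).
have Ho a : j (cor_fun c a) = h a.
  exact: (fob_eq (canonical_lift_upper e) a).
have V m : is_identity (fmor (cor_retr c) m) -> is_identity (fmor p (fmor j m)).
  by move=> I; apply: P; apply: canonical_lift_chosen.
have O x : p (j x) = p (h (cor_retr c x)).
  have := identity_cod (V _ (counit_vertical c x)).
  rewrite !fmor_cod !fmor_dom counit_cod counit_dom => ->.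
  by rewrite Ho.
apply: functor_ext => m /=.
case: (twist_or_identity c m) => [I|[w Hw]].
  rewrite (identityE (V _ I)) !fmor_dom O.
  by rewrite (identityE I) !fmor_id fmor_dom.
have cw := is_twist_cod Hw.
rewrite {1}(is_twist_eq Hw).
do 4! (rewrite fmor_tcomp; last by cs).
rewrite Hf (tcomp_identity_r _ (V _ (twist_vertical Hw))).
  rewrite (tcomp_identity_l _ (V _ (counit_vertical c _))) //.
  by rewrite !fmor_cod !fmor_dom counit_dom Ho.
by rewrite !fmor_cod !fmor_dom cw Ho.
Qed.

(** * The twisted coreflection of a left lifting *)

Section Reconstruct.
Variables (A B : Category) (f : LeftLifting A B).
Local Notation F := (ll_fun f).
Local Notation L := (free_unit F).
Local Notation R := (free_lens F).

Lemma section_eq : R \o L = fun_id B \o F.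
Proof. by rewrite fun_idl; apply: free_proj_unit. Qed.

(** The coalgebra structure on [F] for the comonad which sends a functor to the
    unit [L] of its free lens. *)
Definition ll_section : Functor B (free_cat F) :=
  ll_lift f R L (fun_id B) section_eq.
Local Notation S := ll_section.

Lemma ll_section_upper : S \o F = L.
Proof. exact: ll_upper. Qed.

Lemma ll_section_lower : R \o S = fun_id B.
Proof. exact: ll_lower. Qed.

Lemma ll_free_eq (C D : Category) (l : DeltaLens C D) s t :
  l \o s = t \o F -> l \o s = t \o R \o cor_fun (free_coref F).
Proof. by move=> ->; rewrite -fun_compA /= free_proj_unit. Qed.

(** The canonical lift of the unit against [l] sends formal lifts to chosen
    lifts, hence is a cell from the free lens to [l]; the lifts of [f] are
    natural with respect to this cell. *)
Lemma ll_lift_section (C D : Category) (l : DeltaLens C D) s t e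
    (e' : l \o s = t \o R \o cor_fun (free_coref F)) :
  ll_lift f l s t e = canonical_lift e' \o S.
Proof.
have E1 : l \o (canonical_lift e' \o L) = (t \o fun_id B) \o F.
  rewrite fun_compA canonical_lift_lower -fun_compA section_eq fun_idl.
  by rewrite fun_idr.
rewrite (ll_natural (k' := l) (r0 := canonical_lift e') (r1 := t) _ E1).
  apply: ll_lift_eq; last by rewrite fun_idr.
  by symmetry; apply: (canonical_lift_upper e').
split; first exact: canonical_lift_lower.
move=> x v e1 e2.
have I : is_chosen l (fmor (canonical_lift e') (lift R x v e1)).
  by apply: canonical_lift_chosen; apply: id_identity.
rewrite (is_chosenE I) (liftE e2) fmor_dom (lift_dom e1); f_equal.
apply: (eq_trans (fmor_eq (canonical_lift_lower e') (lift R x v e1))).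
by rewrite -[in RHS](lift_over e1).
Qed.

Lemma ll_lift_ob (C D : Category) (l : DeltaLens C D) s t e x :
  ll_lift f l s t e x =
  cod (tlift l (s (fo_base (S x))) (fmor t (fo_arr (S x)))).
Proof.
have e' := ll_free_eq e; rewrite (ll_lift_section e e') /= canonical_lift_ob /=.
by rewrite free_proj_V //=; apply: id_identity.
Qed.

Lemma ll_lift_chosen (C D : Category) (l : DeltaLens C D) s t e m :
  is_identity (fm_base (fmor S m)) -> is_chosen l (fmor (ll_lift f l s t e) m).
Proof.
have e' := ll_free_eq e; rewrite (ll_lift_section e e') /= => I.
exact: (canonical_lift_chosen e').
Qed.

Definition ll_retr : Functor B A := free_retr F \o S.
Definition ll_counit (x : B) : Mor B := fo_arr (S x).

Lemma ll_counit_dom x : dom (ll_counit x) = F (ll_retr x).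
Proof. by rewrite /ll_counit fo_dom. Qed.

Lemma ll_counit_cod x : cod (ll_counit x) = x.
Proof. exact: (fob_eq ll_section_lower x). Qed.

Lemma ll_section_src m : fm_src (fmor S m) = S (dom m).
Proof. exact: (fmor_dom S). Qed.

Lemma ll_section_tgt m : fm_tgt (fmor S m) = S (cod m).
Proof. exact: (fmor_cod S). Qed.

Lemma ll_section_vertical m : is_identity (fmor ll_retr m) ->
  fm_arr (fmor S m) = m.
Proof.
by move=> I; have /= := fmor_eq ll_section_lower m; rewrite free_proj_V.
Qed.

(** Lift the identity of [B] against the composite of [R] with the free lens
    [R2] on [L].  Lifting in one step sends [x] to the codomain of the formal
    lift, for [R2], of the lift of the counit for [R].  Lifting in two steps,
    the first of which gives [S], sends [x] to the codomain of the formal lift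
    of the image of the counit under [S].  Now an object of the domain of [R2]
    records the morphism lifted. *)
Lemma ll_section_counit x :
  fmor S (ll_counit x) = tlift R (L (ll_retr x)) (ll_counit x).
Proof.
pose L2 := free_unit L; pose R2 := free_lens L.
have e : lens_comp R R2 \o L2 = fun_id B \o F.
  by rewrite /= -fun_compA /L2 !free_proj_unit fun_idl.
have e1 : R \o (R2 \o L2) = fun_id B \o F by rewrite fun_compA.
have Es : ll_lift f R (R2 \o L2) (fun_id B) e1 = S.
  by apply: ll_lift_eq; first exact: (free_proj_unit L).
have e2 : R2 \o L2 = ll_lift f R (R2 \o L2) (fun_id B) e1 \o F.
  by rewrite Es ll_section_upper; exact: (free_proj_unit L).
have H := fob_eq (ll_lens_comp e e2) x.
rewrite (ll_lift_ob e) (ll_lift_ob e2) Es in H.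
have d1 := ll_counit_dom x; have d2 := free_lift_unit_dom d1.
have EL : R2 (L2 (ll_retr x)) = L (ll_retr x) by [].
rewrite lens_comp_tlift in H; last by rewrite EL.
rewrite EL in H; move/(f_equal (fun y => fo_arr y)): H.
rewrite free_lift_unit_arr ?dom_tlift // free_lift_unit_arr; first by move->.
rewrite fmor_dom [dom (fo_arr _)]d1; exact: (fob_eq ll_section_upper).
Qed.

Lemma ll_retr_fun : ll_retr \o F = fun_id A.
Proof. by rewrite -fun_compA ll_section_upper free_retr_unit. Qed.

Lemma ll_retr_counit x : fmor ll_retr (ll_counit x) = id (ll_retr x).
Proof.
rewrite /= ll_section_counit.
by rewrite -(liftE (free_lift_unit_dom (ll_counit_dom x))).
Qed.

Lemma ll_counit_fun a : ll_counit (F a) = id (F a).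
Proof. by rewrite /ll_counit; have /= -> := fob_eq ll_section_upper a. Qed.

(** As [S] is a section of the projection, evaluating the formal composite [S m]
    returns [m]. *)
Lemma ll_twist_over m : ~ is_identity (fmor ll_retr m) ->
  m = ll_counit (cod m) ** (fmor F (fmor ll_retr m) ** fm_arr (fmor S m)).
Proof.
move=> N; have /= := fmor_eq ll_section_lower m.
by rewrite free_proj_T // ll_section_tgt.
Qed.

Lemma ll_twist_counit m : ~ is_identity (fmor ll_retr m) ->
  fm_arr (fmor S m) ** ll_counit (dom m) = id (F (ll_retr (dom m))).
Proof. by move/fm_twisted; rewrite ll_section_src. Qed.

Lemma ll_counit_nat m : m ** ll_counit (dom m) =
  ll_counit (cod m) ** fmor F (fmor ll_retr m).
Proof.
rewrite /ll_counit -ll_section_src -ll_section_tgt -free_proj_nat.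
by have /= -> := fmor_eq ll_section_lower m.
Qed.

Definition ll_counit_trans : NatTrans (F \o ll_retr) (fun_id B).
Proof.
refine {| component := ll_counit |}.
- exact: ll_counit_dom.
- exact: ll_counit_cod.
- by move=> m e e'; rewrite !compE; apply: ll_counit_nat.
Defined.

Definition ll_split : SplitCoreflection A B.
Proof.
refine {| cor_fun := F; cor_retr := ll_retr; counit := ll_counit_trans |}.
- exact: ll_retr_fun.
- exact: ll_retr_counit.
- exact: ll_counit_fun.
Defined.

Lemma ll_is_twist m : ~ is_identity (fmor ll_retr m) ->
  is_twist ll_split m (fm_arr (fmor S m)).
Proof.
move=> N; have E := ll_twist_over N.
have e1 : cod (fm_arr (fmor S m)) = F (ll_retr (dom m)).
  by rewrite fm_twisted_cod // ll_section_src.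
apply/is_twistE; split.
  by rewrite fm_arr_dom ll_section_src; apply: ll_counit_cod.
split=> //; split; first exact: ll_twist_counit.
by rewrite {1}E tcompA // ?fmor_cod ?ll_counit_dom // e1 !fmor_dom.
Qed.

(** [S] carries twists to twists for the free coreflection, which are unique,
    and the morphism stored in [S w] is [w], since [w] lies over an identity. *)
Lemma ll_is_twist_arr m w : ~ is_identity (fmor ll_retr m) ->
  is_twist ll_split m w -> w = fm_arr (fmor S m).
Proof.
move=> N H; have dw := is_twist_dom H; have cw := is_twist_cod H.
rewrite -[LHS](ll_section_vertical (twist_vertical H)).
apply: (free_twist_arr N); apply/is_twistE.
have SF n : fmor S (fmor F n) = fmor L n by exact: (fmor_eq ll_section_upper n).
have SO a : S (F a) = L a by exact: (fob_eq ll_section_upper a).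
have SC y : fmor S (ll_counit y) = counit (free_coref F) (S y).
  by rewrite ll_section_counit free_counit_lift.
split; first by rewrite !fmor_dom dw.
split; first by rewrite fmor_cod cw SO fmor_dom.
have /is_twistE [_ [_ [H1 H2]]] := H; split.
  rewrite !fmor_dom -(SC (dom m)).
  rewrite -fmor_tcomp; last by rewrite ll_counit_cod.
  by rewrite [_ ** _]H1 fmor_id SO.
move/(f_equal (fmor S)): H2.
rewrite fmor_tcomp; last first.
  by rewrite dom_tcomp ?cw; cs.
rewrite fmor_tcomp; last by cs.
by rewrite SF [fmor S (counit _ _)]SC fmor_cod.
Qed.

Definition ll_coref : TwistedCoreflection A B.
Proof.
refine {| tw_split := ll_split |} => m N.
exists (fm_arr (fmor S m)); split; first exact: ll_is_twist.
by move=> w /(ll_is_twist_arr N).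
Defined.

(** Canonical lifts are characterised by sending the morphisms over identities
    to chosen lifts; the lifts of [f] do so as they factor through [S], which
    sends these morphisms to formal lifts. *)
Lemma canonical_ll_coref : canonical_ll ll_coref = f.
Proof.
apply: ll_ext => // C D l s t e e'; symmetry; apply: canonical_lift_eq.
- exact: ll_upper.
- exact: ll_lower.
- by move=> m I; apply: ll_lift_chosen.
Qed.

End Reconstruct.

(** * The inverse double functor *)

Lemma ll_retr_canonical (A B : Category) (c : TwistedCoreflection A B) :
  ll_retr (canonical_ll c) = cor_retr c.
Proof.
rewrite /ll_retr /ll_section /= (canonical_lift_retr _ (p := free_retr _)).
  by rewrite free_retr_unit fun_idl.
exact: free_chosen_vertical.
Qed.

Lemma ll_counit_canonical (A B : Category) (c : TwistedCoreflection A B) x :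
  ll_counit (canonical_ll c) x = counit c x.
Proof.
rewrite /ll_counit /ll_section /= canonical_lift_ob free_lift_unit_arr //.
exact: counit_dom.
Qed.

Lemma ll_coref_canonical (A B : Category) (c : TwistedCoreflection A B) :
  ll_coref (canonical_ll c) = c.
Proof.
apply: twisted_ext => //; first exact: ll_retr_canonical.
exact: ll_counit_canonical.
Qed.

(** Lifting against the free lens on [ll_fun g] turns the equation between lifts
    into one between sections, whose two components are the retractions and the
    counits. *)
Lemma ll_coref_cell (A B C D : Category) (f : LeftLifting A C)
    (g : LeftLifting B D) (h : Functor A B) (k : Functor C D) :
  ll_cell f g h k -> twisted_cell (ll_coref f) (ll_coref g) h k.
Proof.
case=> E H; split=> //=.
have e : free_lens (ll_fun g) \o (free_unit (ll_fun g) \o h) =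
    (fun_id D \o k) \o ll_fun f.
  by rewrite fun_compA section_eq !fun_idl E.
have ES : ll_section g \o k =
    ll_lift f (free_lens (ll_fun g)) (free_unit (ll_fun g) \o h)
    (fun_id D \o k) e.
  exact: H.
split.
- rewrite /ll_retr -(fun_compA _ _ k) ES.
  rewrite (ll_lift_section _ (ll_free_eq e)) (fun_compA (free_retr (ll_fun g))).
  rewrite canonical_lift_retr.
    by rewrite (fun_compA _ _ h) free_retr_unit fun_idl -fun_compA.
  exact: free_chosen_vertical.
- move=> x; rewrite /ll_counit.
  have /= -> := f_equal (fun y => fo_arr y) (fob_eq ES x).
  rewrite ll_lift_ob free_lift_unit_arr //.
  rewrite fmor_dom fo_dom; exact: (fob_eq E).
Qed.

Lemma df_ext (D E : ThinDoubleCategory) (ob : D -> E) h v h' v'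
    a1 a2 a3 a4 a5 b1 b2 b3 b4 b5 : h = h' -> v = v' ->
  @Build_DoubleFunctor D E ob h v a1 a2 a3 a4 a5 =
  @Build_DoubleFunctor D E ob h' v' b1 b2 b3 b4 b5.
Proof. by move=> Eh Ev; subst; f_equal; apply: proof_irrelevance. Qed.

(** The vertical laws need only be checked after applying the canonical double
    functor, which is injective on vertical morphisms. *)
Definition ll_coref_functor : DoubleFunctor LLPLens TwCoref.
Proof.
refine {| df_ob := fun A : LLPLens => A : TwCoref;
  df_hor := fun A B (h : @hor LLPLens A B) => h : @hor TwCoref A B;
  df_ver := fun A B (f : @ver LLPLens A B) => ll_coref f |} => //=.
- move=> A; rewrite -[RHS]ll_coref_canonical.
  by have /= -> := df_vid canonical_double_functor A.
- move=> A B C g f; rewrite -[RHS]ll_coref_canonical.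
  have /= -> := df_vcomp canonical_double_functor (ll_coref g) (ll_coref f).
  by rewrite !canonical_ll_coref.
- by move=> *; apply: ll_coref_cell.
Defined.

Theorem proposition46 : df_invertible canonical_double_functor.
Proof.
exists ll_coref_functor; split; apply: df_ext => //;
  do 3! (apply: functional_extensionality_dep => ?).
- exact: ll_coref_canonical.
- exact: canonical_ll_coref.
Qed.
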